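(* For every integer $r \ge 2$ there is $n_0 = n_0(r)$ such that for every integer $n \ge n_0$, the largest possible size of a difference-isomorphic family of $r$-graphs on $[n]$ equals $2^{f_r(n)}$.
   Context: An $r$-graph on $[n]=\{1,\dots,n\}$ is an $r$-uniform hypergraph with vertex set $[n]$, identified with its edge set, a subset of $\binom{[n]}{r}$. For $r$-graphs $G_1,G_2$ on $[n]$, $G_1\setminus G_2$ is the $r$-graph on $[n]$ with edge set $E(G_1)\setminus E(G_2)$. A family (set) $\mathcal{G}$ of $r$-graphs on $[n]$ is difference-isomorphic if for every $G_1,G_2\in\mathcal{G}$ the $r$-graphs $G_1\setminus G_2$ and $G_2\setminus G_1$ are isomorphic (i.e. some permutation of $[n]$ maps the edge set of the first onto that of the second). Define $f_r(n)=\frac12\binom{n}{r}$ if $r$ is odd and $n$ is even, and $f_r(n)=\frac12\big(\binom{n}{r}-\binom{\lfloor n/2\rfloor}{\lfloor r/2\rfloor}\big)$ otherwise. *)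

(* Defs.v *)
From mathcomp Require Import all_boot all_fingroup.

Set Implicit Arguments.
Unset Strict Implicit.
Unset Printing Implicit Defensive.

(* The vertex set [n] is 'I_n; a hypergraph is identified with its edge set. *)
Definition hypergraph (n : nat) := {set {set 'I_n}}.

Definition is_rgraph (r n : nat) (G : hypergraph n) : bool :=
  [forall e in G, #|e| == r].

Definition isomorphic (n : nat) (G H : hypergraph n) : bool :=
  [exists s : {perm 'I_n}, [set s @: (e : {set 'I_n}) | e in G] == H].

Definition difference_isomorphic (n : nat) (F : {set hypergraph n}) : bool :=
  [forall G1 in F, forall G2 in F, isomorphic (G1 :\: G2) (G2 :\: G1)].

Definition rgraph_family (r n : nat) (F : {set hypergraph n}) : bool :=
  [forall G in F, is_rgraph r G].

(* The maximum is over a nonempty collection, since the empty family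
   qualifies; the default value 0 of \max therefore plays no role. *)
Definition max_difference_isomorphic (r n : nat) : nat :=
  \max_(F : {set hypergraph n} | rgraph_family r F && difference_isomorphic F)
     #|F|.

(* [n./2] is the floor of n / 2; [f_r_exact] below shows that neither the
   subtraction nor the outer halvings round. *)
Definition f_r (r n : nat) : nat :=
  if odd r && ~~ odd n then 'C(n, r)./2
  else ('C(n, r) - 'C(n./2, r./2))./2.

Lemma odd_bin_double (n r : nat) :
  (odd 'C(n.*2, r.*2) = odd 'C(n, r)) * (odd 'C(n.*2, r.*2.+1) = false).
Proof.
elim: n r => [|n IHn] [|r]; split=> //=; rewrite ?bin0 ?bin1 ?odd_double //.
  rewrite !doubleS !binS !oddD -!doubleS !IHn.
  by case: (odd _); case: (odd _).
rewrite !doubleS !binS !oddD -!doubleS !IHn.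
by case: (odd _); case: (odd _).
Qed.

Lemma leq_bin_double (n r : nat) : 'C(n, r) <= 'C(n.*2, r.*2).
Proof.
elim: n r => [|n IHn] [|r]; rewrite ?bin0 //.
rewrite !doubleS !binS -addnA -!doubleS leq_add //.
by apply: leq_trans (IHn r) _; rewrite addnA leq_addl.
Qed.

Lemma f_r_exact (r n : nat) :
  (f_r r n).*2 + (if odd r && ~~ odd n then 0 else 'C(n./2, r./2)) = 'C(n, r).
Proof.
have key (a b : nat) : b <= a -> odd a = odd b -> (a - b)./2.*2 + b = a.
  by move=> le_ba ab; rewrite even_halfK ?oddB ?ab ?addbb // subnK.
rewrite /f_r; set m := n./2; set k := r./2.
have -> : 'C(n, r) = 'C(odd n + m.*2, odd r + k.*2) by rewrite !odd_double_half.
case: (odd n); case: (odd r) => /=; rewrite ?add1n ?add0n.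
- apply: key; rewrite ?binS ?oddD ?odd_bin_double //.
  exact: leq_trans (leq_bin_double m k) (leq_addl _ _).
- case: k => [|k]; first by rewrite !bin0.
  apply: key; rewrite doubleS ?binS ?oddD -?binS -?doubleS
    ?odd_bin_double ?addbF //.
  rewrite doubleS binS -doubleS.
  exact: leq_trans (leq_bin_double m k.+1) (leq_addr _ _).
- by rewrite addn0 even_halfK // odd_bin_double.
- by apply: key; rewrite ?odd_bin_double // leq_bin_double.
Qed.

(* Main.v *)
Require Import Defs.
From mathcomp Require Import all_boot all_fingroup all_algebra.
From mathcomp Require Import zify ring.

(** Write N for the number of [r]-sets of vertices and w for the number of
those that are invariant under an involution of the vertices with at most one
fixed point; then 2 f + w = N, where f is the exponent [f_r r n].

Lower bound. Fix such an involution iota. The hypergraphs that contain no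
invariant edge and exactly one edge of each orbit of size two are 2^f in
number, and iota itself maps G1 \ G2 onto G2 \ G1 for any two of them.

Upper bound. Let F be a difference-isomorphic family with more than 2^f
members. The hypergraphs that a fixed permutation s relates to a given K0 lie
in a cube: from each of certain disjoint pairs of edges exactly one is chosen,
and everything else is frozen ([reach_cube]). Relatedness of K and K' by s,
for K and K' in two cubes, is a constraint at every edge, and independent
constraints can be found at a positive proportion of the edges unless s
exchanges the two edges of pairs that belong to both cubes ([pair_bound]).
Since K and K' agree on the s-invariant edges, one gets the sharper
[norm_bound], in effect a bound on the norm of the matrix of the relation.
So if S is a large part of F inside one cube, then a permutation that relates
many elements of S to elements of another such part is determined by S up to
few edges. All n! permutations compete at first, and then only permutations
at distance O(log n) from each other matter; averaging gives a base
hypergraph related to most of F by 2^(O((log n)^2)) permutations. In a second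
round with these permutations the tolerance is smaller than the distance of
any two permutations, and a single one remains, an involution s
([popular_round], used twice in [upper_bound]). Hence F contains more than
three quarters of a cube C of s, and C has 2^f elements.

Finally, every G in F belongs to C, which contradicts the size of F. The
number Q(H) of ordered pairs of edges of H with [r.-1] common vertices is an
isomorphism invariant, so Q(G \ K) = Q(K \ G) for more than three quarters of
the K in C. Both sides are quadratic in the bits that describe K, so the
differences of second order of this equation vanish identically
([four_toggles]). Their coefficients show that G contains exactly one edge of
each orbit of size two ([moved_edges_split]) and agrees with C on the
invariant edges ([gap0]). *)

Set Implicit Arguments.
Unset Strict Implicit.
Unset Printing Implicit Defensive.
Import GRing.Theory.

(** * Counting inequalities *)

Lemma leq_expn_base a b e : a <= b -> a ^ e <= b ^ e.
Proof. by case: e => [|e] ab; rewrite ?expn0 // leq_exp2r. Qed.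

Lemma card_fibers (I J : finType) (f : I -> J) (B : {set I}) :
  #|B| = \sum_(j : J) #|[set a in B | f a == j]|.
Proof.
rewrite -sum1_card (partition_big f xpredT) //=; apply: eq_bigr => j _.
by rewrite -sum1_card; apply: eq_bigl => a; rewrite inE.
Qed.

(** The Cauchy-Schwarz inequality for the numbers [e i] bounded by the square
roots of [x i * y i * P]. *)
Lemma cauchy_nat (I : finType) (x y e : I -> nat) P :
  (forall i, e i ^ 2 <= x i * y i * P) ->
  (\sum_i e i) ^ 2 <= (\sum_i x i) * (\sum_i y i) * P.
Proof.
move=> h; rewrite -(@leq_pmul2l 2) //.
have agm a b c : a ^ 2 <= b * c -> 2 * a <= b + c.
  by move=> hbc; rewrite -leq_sqr expnMn (leq_trans _ (nat_AGM2 b c)) // leq_mul2l.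
rewrite [X in _ <= X](_ : _ = \sum_i \sum_j (x i * y j * P + x j * y i * P)).
  rewrite expnS expn1 big_distrlr /= big_distrr /=; apply: leq_sum => i _.
  rewrite big_distrr /=; apply: leq_sum => j _; apply: agm.
  apply: leq_trans (_ : (e i ^ 2) * (e j ^ 2) <= _); first by rewrite -expnMn.
  by apply: leq_trans (leq_mul (h i) (h j)) _; lia.
have e1 : \sum_i \sum_j x i * y j * P = (\sum_i x i) * (\sum_i y i) * P.
  rewrite big_distrlr /= big_distrl /=; apply: eq_bigr => i _.
  by rewrite big_distrl.
rewrite [RHS](eq_bigr (fun i => \sum_j x i * y j * P + \sum_j x j * y i * P)); last first.
  by move=> i _; rewrite big_split.
rewrite big_split /= e1 exchange_big /= e1; lia.
Qed.

Lemma bin_leq_exp a k : 'C(a, k) <= a ^ k.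
Proof.
apply: (@leq_trans (a ^_ k)); first by rewrite -bin_ffact leq_pmulr ?fact_gt0.
elim: k => [|k IH]; first by rewrite ffactn0 expn0.
by rewrite ffactnSr expnSr leq_mul // leq_subr.
Qed.

Lemma fact_le k : k`! <= k ^ k.
Proof.
elim: k => // k IH; rewrite factS expnS leq_mul2l /=.
by apply: leq_trans IH _; apply: leq_expn_base.
Qed.

(** * Related sets and cubes *)

Section Cubes.
Variable T : finType.
Implicit Types (g : {perm T}) (K A E : {set T}) (X Y : {set {set T}}).

(** The two differences are isomorphic through the prescribed [g]. *)
Definition swaps g K1 K2 := g @: (K1 :\: K2) == K2 :\: K1.

Lemma swapsP g K1 K2 :
  reflect (forall e, (e \in K1 :\: K2) = (g e \in K2 :\: K1)) (swaps g K1 K2).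
Proof.
apply: (iffP eqP) => [<- e|H]; first by rewrite mem_imset //; apply: perm_inj.
apply/setP=> e; rewrite -[e](permKV g) mem_imset ?H //; exact: perm_inj.
Qed.

Definition nswaps g X Y : nat :=
  #|[set p : {set T} * {set T} | [&& p.1 \in X, p.2 \in Y & swaps g p.1 p.2]]|.

Lemma nswaps_le g X Y : nswaps g X Y <= #|X| * #|Y|.
Proof.
rewrite -cardsX subset_leq_card //; apply/subsetP=> p.
by rewrite !inE => /and3P[-> ->].
Qed.

(** A partial matching of [E] is encoded as an involution whose fixed elements
are the unmatched ones. *)
Definition matching E (m : T -> T) :=
  (forall e, m (m e) = e) /\ (forall e, e \in E -> m e \in E).

(** One free bit for each matched pair; the base point [A] decides the unmatched
elements. *)
Definition cube E (m : T -> T) A : {set {set T}} :=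
  [set K : {set T} | (K \subset E) &&
     [forall e in E, (e \in K) == if m e == e then e \in A else m e \notin K]].

Lemma cubeP E m A K :
  reflect (K \subset E /\
    forall e, e \in E -> (e \in K) = if m e == e then e \in A else m e \notin K)
    (K \in cube E m A).
Proof.
rewrite inE; apply: (iffP andP) => -[-> H]; split=> //.
  by move=> e eE; apply/eqP/(forall_inP H).
by apply/forall_inP=> e eE; rewrite H.
Qed.

Definition unmatched E (m : T -> T) : {set T} := [set e in E | m e == e].

Definition reps E (m : T -> T) : {set T} :=
  [set e in E | enum_rank e < enum_rank (m e)].

Lemma card_reps E m : matching E m -> #|reps E m| * 2 + #|unmatched E m| = #|E|.
Proof.
move=> [mK mE].
have mI : injective m by apply: can_inj mK.
have -> : #|E| = #|reps E m :|: (m @: reps E m) :|: unmatched E m|.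
  congr #|pred_of_set _|; apply/setP=> e; rewrite !inE -[e in e \in m @: _]mK (mem_imset _ _ mI) !inE mK.
  have -> : (m e \in E) = (e \in E).
    by apply/idP/idP=> /mE //; rewrite mK.
  rewrite -(inj_eq (@enum_rank_inj T)) -val_eqE /=.
  by case: (e \in E) => //=; case: ltngtP.
rewrite cardsU cardsU (card_imset _ mI).
have -> : reps E m :&: m @: reps E m = set0.
  apply/setP=> e; rewrite !inE -[e in e \in m @: _]mK (mem_imset _ _ mI) !inE mK.
  by case: (e \in E) => //=; case: ltngtP; rewrite ?andbF.
have -> : (reps E m :|: m @: reps E m) :&: unmatched E m = set0.
  apply/setP=> e; rewrite !inE -[e in e \in m @: _]mK (mem_imset _ _ mI) !inE mK.
  rewrite -(inj_eq (@enum_rank_inj T)) -val_eqE /=.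
  by case: (e \in E) => //=; case: ltngtP; rewrite ?andbF.
rewrite !cards0; lia.
Qed.

Lemma card_cube_le E m A : matching E m -> #|cube E m A| <= 2 ^ #|reps E m|.
Proof.
move=> [mK mE]; rewrite -card_powerset.
have inj : {in cube E m A &, injective (fun K : {set T} => K :&: reps E m)}; last first.
  rewrite -(card_in_imset inj); apply: subset_leq_card.
  by apply/subsetP=> _ /imsetP[K _ ->]; rewrite inE subsetIr.
move=> K1 K2 /cubeP[sK1 H1] /cubeP[sK2 H2] /setP eqK; apply/setP=> e.
have [eE|eE] := boolP (e \in E); last first.
  by rewrite !(negbTE (contra (subsetP _ _) eE)).
have [me|me] := eqVneq (m e) e; first by rewrite (H1 _ eE) (H2 _ eE) me eqxx.
have [lt|le] := ltnP (enum_rank e) (enum_rank (m e)).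
  by have := eqK e; rewrite !inE eE lt !andbT.
have lt : enum_rank (m e) < enum_rank e.
  rewrite ltn_neqAle le andbT; apply: contra me => /eqP.
  by move=> /val_inj/enum_rank_inj ->.
have := eqK (m e); rewrite (H1 _ eE) (H2 _ eE) (negbTE me) !inE mE // mK lt !andbT.
by move=> ->.
Qed.

Lemma card_cube_ge E m A : matching E m ->
  2 ^ #|reps E m| <= #|cube E m A|.
Proof.
move=> [mK mE]; rewrite -card_powerset.
pose f (S : {set T}) : {set T} := [set e in E | if m e == e then e \in A
  else if e \in reps E m then e \in S else m e \notin S].
have inf S e : (e \in f S) = (e \in E) && (if m e == e then e \in A
  else if e \in reps E m then e \in S else m e \notin S) by rewrite in_set.
have fI : {in powerset (reps E m) &, injective f}.
  move=> S1 S2; rewrite !inE => s1 s2 /setP h; apply/setP=> e.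
  have [er|er] := boolP (e \in reps E m); last first.
    by rewrite !(negbTE (contra (subsetP _ _) er)).
  have /setIdP[eE lt] := er.
  have me : m e == e = false by apply/negP=> /eqP me; move: lt; rewrite me ltnn.
  by have := h e; rewrite !inf eE me er.
rewrite -(card_in_imset fI); apply/subset_leq_card/subsetP=> _ /imsetP[S _ ->].
apply/cubeP; split; first by apply/subsetP=> e; rewrite inf => /andP[].
move=> e eE; rewrite !inf eE (mE _ eE) /=; case: (eqVneq (m e) e) => // me.
rewrite mK eq_sym (negbTE me) !in_set eE (mE _ eE) /= mK.
have : enum_rank e != enum_rank (m e) :> nat.
  by apply: contra me => /eqP/val_inj/enum_rank_inj <-.
by case: ltngtP => //= _ _; rewrite negbK.
Qed.

Lemma card_cube_sqr E m A :
  matching E m -> #|cube E m A| ^ 2 * 2 ^ #|unmatched E m| <= 2 ^ #|E|.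
Proof.
move=> mm; rewrite -(card_reps mm) expnD expnM leq_mul2r leq_sqr.
by rewrite card_cube_le ?orbT.
Qed.

End Cubes.

Section SetBit.
Variables (T : finType) (E : {set T}) (m : T -> T) (A : {set T}).
Hypothesis mm : matching E m.
Implicit Types (K : {set T}) (b : bool) (e : T).

Definition set_bit b e K := if b then e |: (K :\ m e) else (m e |: K) :\ e.

Arguments set_bit : simpl never.

Lemma in_set_bit b e K x : m e != e ->
  (x \in set_bit b e K) = if x == e then b else if x == m e then ~~ b else x \in K.
Proof.
move=> ne; rewrite /set_bit; case: b; rewrite !inE.
  by case: eqVneq => //= _; case: eqVneq.
by case: eqVneq => //= _; case: eqVneq.
Qed.

Lemma set_bit_cube b e K :
  e \in E -> m e != e -> K \in cube E m A -> set_bit b e K \in cube E m A.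
Proof.
move=> eE ne /cubeP[sK HK]; case: mm => mK mE; apply/cubeP; split.
  apply/subsetP=> x; rewrite in_set_bit //; case: eqVneq => [->//|_].
  by case: eqVneq => [-> _|_ /(subsetP sK)//]; apply: mE.
move=> x xE; rewrite !in_set_bit // (HK _ xE).
case: (eqVneq x e) => [->|xe]; first by rewrite (negbTE ne) eqxx negbK.
case: (eqVneq x (m e)) => [->|xme].
  by rewrite mK eq_sym (negbTE ne) eqxx.
case: ifP => // mx; rewrite (_ : (m x == e) = false) ?(inj_eq (can_inj mK)) ?(negbTE xe) //.
by apply: contraNF xme => /eqP <-; rewrite mK.
Qed.

Lemma set_bit_inj b e K1 K2 : e \in E -> m e != e ->
  K1 \in cube E m A -> K2 \in cube E m A ->
  (e \in K1) = (e \in K2) -> set_bit b e K1 = set_bit b e K2 -> K1 = K2.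
Proof.
move=> eE ne /cubeP[_ H1] /cubeP[_ H2] be /setP eqK; apply/setP=> x.
have := eqK x; rewrite !in_set_bit //; case: eqVneq => [-> //|xe].
case: eqVneq => [-> _|//]; case: mm => mK mE.
by rewrite (H1 _ (mE _ eE)) (H2 _ (mE _ eE)) mK eq_sym (negbTE ne) be.
Qed.

End SetBit.
Arguments set_bit {T} m b e K : simpl never.

(** * Related pairs in two cubes *)

Section Pairs.
Variables (T : finType) (E : {set T}) (g : {perm T}) (m m' : T -> T).
Variables (A A' : {set T}).
Hypothesis mm : matching E m.
Hypothesis mm' : matching E m'.

(** The elements at which relatedness by [g] costs nothing: there all four
combinations of the two free bits are allowed. *)
Definition exchanged e := [&& m e != e, m e == g e, m' e == g e & g (g e) == e].
Definition both_matched e := [&& e \in E, m e != e & m' e != e].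
(** If [e] lies in K but not in K', then [g e] must lie in K' but not in K. When
[g] does not follow one of the two matchings at [e], one of these requirements
is not enforced by the matchings, and breaking it gives the forbidden pattern
[violates e]. *)
Definition obstructed e :=
  [&& both_matched e, both_matched (g e) & (m e != g e) || (m' e != g e)].
Definition violates e (p : {set T} * {set T}) :=
  [&& e \in p.1, e \notin p.2 & if m e != g e then g e \in p.1 else g e \notin p.2].
Definition avoid (S : {set T}) : {set {set T} * {set T}} :=
  [set p | [&& p.1 \in cube E m A, p.2 \in cube E m' A'
             & [forall e in S, ~~ violates e p]]].

Lemma in_avoid S p : (p \in avoid S) =
  [&& p.1 \in cube E m A, p.2 \in cube E m' A' & [forall e in S, ~~ violates e p]].
Proof. exact: in_set. Qed.

Definition violate e (p : {set T} * {set T}) :=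
  (set_bit m true e (if m e != g e then set_bit m true (g e) p.1 else p.1),
   set_bit m' false e (if m e != g e then p.2 else set_bit m' false (g e) p.2)).

Lemma violate_cube e p : obstructed e ->
  p.1 \in cube E m A -> p.2 \in cube E m' A' ->
  ((violate e p).1 \in cube E m A) && ((violate e p).2 \in cube E m' A').
Proof.
case/and3P=> /and3P[eE ne ne'] /and3P[gE' gne gne'] _ c c'.
rewrite /violate; case: ifP => _ /=; by rewrite ?(set_bit_cube mm) ?(set_bit_cube mm').
Qed.

Lemma violate_violates e p : obstructed e -> violates e (violate e p).
Proof.
case/and3P=> /and3P[eE ne ne'] /and3P[gE' gne gne'] d.
rewrite /violates /violate; case: ifP => h /=; rewrite !in_set_bit // !eqxx /=.
  by case: (g e == e) => //; rewrite eq_sym (negbTE h).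
move: d; rewrite h /= => h'; case: (g e == e) => //.
by rewrite eq_sym (negbTE h').
Qed.

Definition touched e : {set T} :=
  [set e; g e; m e; m (g e); m' e; m' (g e)].

Lemma violate_mem e p x : obstructed e -> x \notin touched e ->
  ((x \in (violate e p).1) = (x \in p.1)) * ((x \in (violate e p).2) = (x \in p.2)).
Proof.
case/and3P=> /and3P[eE ne ne'] /and3P[gE' gne gne'] _.
rewrite !inE !negb_or -!andbA => /and5P[/negbTE h1 /negbTE h2 /negbTE h3 /negbTE h4].
move=> /andP[/negbTE h5 /negbTE h6].
by rewrite /violate; case: ifP => _; rewrite /= !in_set_bit // ?h1 ?h2 ?h3 ?h4 ?h5 ?h6.
Qed.

(** Imposing the forbidden pattern at [e] overwrites four bits, so it is at most
16-to-1, and it leaves the patterns of [S] alone. So at least one pair in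
sixteen that avoids [S] violates [e]. *)
Lemma avoid_step (S : {set T}) e : obstructed e ->
  {in S, forall x, (x \notin touched e) && (g x \notin touched e)} ->
  #|avoid (e |: S)| * 16 <= 15 * #|avoid S|.
Proof.
move=> st far.
pose F := [set p in avoid S | violates e p].
have eqA : avoid (e |: S) = avoid S :\: F.
  apply/setP=> p; rewrite in_setD [p \in F]in_set !in_avoid.
  case: (p.1 \in _) => //=; rewrite ?andbF //.
  case: (p.2 \in _) => //=; rewrite ?andbF //.
  have [H|/forall_inP H] /= := boolP [forall e0 in S, ~~ violates e0 p]; rewrite ?andbF.
    rewrite andbT; apply/forall_inP/idP=> [->//|H1 x]; first by rewrite inE set11.
    by rewrite in_setU1 => /orP[/eqP ->//|xS]; apply: (forall_inP H).
  apply/forall_inP=> H1; apply: H => x xS; apply: H1.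
  by rewrite in_setU1 xS orbT.
have sF : F \subset avoid S by apply/subsetP=> p; rewrite inE => /andP[].
have fib : #|avoid S| <= #|F| * 16.
  pose h (p : {set T} * {set T}) :=
    (violate e p, ((e \in p.1, g e \in p.1), (e \in p.2, g e \in p.2))).
  have hI : {in avoid S &, injective h}.
    case=> [K1 K1'] [K2 K2']; rewrite !in_avoid /= => /and3P[c1 c1' _] /and3P[c2 c2' _].
    rewrite /h /violate /= => -[e1 e2 b1 b2 b3 b4].
    case/and3P: st => /and3P[eE ne ne'] /and3P[gE' gne gne'] d.
    move: e1 e2; case: ifP => hmg e1 e2.
      congr (_, _); last by apply: (set_bit_inj (A := A') mm' eE ne' c1' c2' b3 e2).
      apply: (set_bit_inj (A := A) mm gE' gne c1 c2 b2).
      apply: (set_bit_inj (A := A) mm eE ne _ _ _ e1); rewrite ?(set_bit_cube mm) //.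
      by rewrite !in_set_bit // b1.
    congr (_, _); first by apply: (set_bit_inj (A := A) mm eE ne c1 c2 b1 e1).
    apply: (set_bit_inj (A := A') mm' gE' gne' c1' c2' b4).
    apply: (set_bit_inj (A := A') mm' eE ne' _ _ _ e2); rewrite ?(set_bit_cube mm') //.
    by rewrite !in_set_bit // b3.
  rewrite -(card_in_imset hI).
  have -> : 16 = #|[set: (bool * bool) * (bool * bool)]|.
    by rewrite cardsT !card_prod card_bool.
  rewrite -cardsX subset_leq_card //; apply/subsetP=> _ /imsetP[p pA ->].
  move: (pA); rewrite in_avoid => /and3P[c c' /forall_inP av].
  rewrite in_setX in_setT andbT in_set in_avoid violate_violates // andbT.
  have /andP[-> ->] := violate_cube st c c'; rewrite /=; apply/forall_inP=> x xS.
  have /andP[f1 f2] := far _ xS; have := av _ xS.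
  by rewrite /violates !(violate_mem p st f1) !(violate_mem p st f2).
have := cardsID F (avoid S); rewrite (setIidPr sF) -eqA.
lia.
Qed.

(** Greedy choice of obstructed elements with unrelated patterns: [x] and [g x]
must both avoid the six elements touched by [e], so each choice discards at
most twelve elements. *)
Lemma avoid_bound (S : {set T}) : {in S, forall e, obstructed e} ->
  exists i, #|S| <= 12 * i /\ #|avoid S| * 16 ^ i <= 15 ^ i * (#|cube E m A| * #|cube E m' A'|).
Proof.
have [n] := ubnP #|S|; elim: n S => // n IH S; rewrite ltnS => leS st.
have [->|[e eS]] := set_0Vmem S.
  exists 0; rewrite cards0 !muln1 mul1n; split=> //.
  rewrite -cardsX subset_leq_card //; apply/subsetP=> p.
  by rewrite in_avoid [p \in setX _ _]in_set => /and3P[-> ->].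
pose S' := [set x in S | (x \notin touched e) && (g x \notin touched e)].
have eS' : e \notin S' by rewrite !inE eqxx !orTb andbF.
have sS' : S' \subset S by apply/subsetP=> x; rewrite inE => /andP[].
have cS' : #|S'| < #|S|.
  rewrite proper_card // properE sS'; apply/subsetPn; exists e => //.
have big : #|S| <= #|S'| + 12.
  have c6 : #|touched e| <= 6.
    rewrite /touched !cardsU !cards1; lia.
  have c6' : #|g @^-1: touched e| <= 6.
    by rewrite -[g @^-1: _](can2_imset_pre _ (permKV g) (permK g)) card_imset //; apply: perm_inj.
  have : S \subset S' :|: (touched e :|: g @^-1: touched e).
    apply/subsetP=> x xS; rewrite in_setU [x \in S']in_set xS in_setU [x \in _ @^-1: _]in_set /=.
    by case: (x \in touched e); case: (g x \in touched e); rewrite ?orbT.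
  move/subset_leq_card => h0.
  have [h1 _] := leq_card_setU S' (touched e :|: g @^-1: touched e).
  have [h2 _] := leq_card_setU (touched e) (g @^-1: touched e).
  lia.
case: (IH S'); [lia|by move=> x /(subsetP sS')/st|] => i [i1 i2].
exists i.+1; split; first lia.
have far : {in S', forall x, (x \notin touched e) && (g x \notin touched e)}.
  by move=> x; rewrite inE => /andP[].
have stp := avoid_step (st _ eS) far.
have sub : #|avoid S| <= #|avoid (e |: S')|.
  apply/subset_leq_card/subsetP=> p; rewrite !in_avoid => /and3P[-> -> /forall_inP H] /=.
  apply/forall_inP=> x; rewrite in_setU1 => /orP[/eqP->|/(subsetP sS')]; exact: H.
rewrite !expnS; move: (16 ^ i) (15 ^ i) i2 => a b i2.
nia.
Qed.

End Pairs.

(** An element that [g] does not exchange costs a factor 2^(-1/kappa). Since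
(15/16)^24 <= 1/4, the 24th power of the number of related pairs loses a factor
4 for each independent obstruction, and one obstructed element in twelve can
be made independent; 288 = 24 * 12. *)
Definition kappa := 288.

Lemma pow15_16 : 15 ^ 24 * 2 ^ 2 <= 16 ^ 24.
Proof.
have sqr a b : a ^ 12 * 2 <= b ^ 12 -> a ^ 24 * 2 ^ 2 <= b ^ 24.
  by move=> h; rewrite (expnM a 12 2) (expnM b 12 2) -expnMn leq_expn_base.
by apply: sqr; lia.
Qed.

Section PairBound.
Variables (T : finType) (E : {set T}) (g : {perm T}) (m m' : T -> T).
Variables (A A' : {set T}).
Hypothesis mm : matching E m.
Hypothesis mm' : matching E m'.
Hypothesis gE : forall e, (g e \in E) = (e \in E).

Lemma swaps_avoid :
  nswaps g (cube E m A) (cube E m' A')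
    <= #|avoid E g m m' A A' [set e | obstructed E g m m' e]|.
Proof.
apply/subset_leq_card/subsetP=> -[K K'].
rewrite in_avoid in_set /= => /and3P[-> -> /swapsP H] /=.
apply/forall_inP=> e _; apply/negP; rewrite /violates /= => /and3P[e1 e2].
have := H e; rewrite !inE e1 e2 /= => /esym/andP[h1 h2].
by rewrite (negbTE h1) h2; case: ifP.
Qed.

(** Suppose that [e], [g e] and [g (g e)] are matched on both sides and that [e]
is neither exchanged nor obstructed. Then [g e] is the partner of [e] on both
sides while [g (g e)] is not [e], so [g e] is obstructed. *)
Lemma card_bad :
  #|[set e in E | ~~ exchanged g m m' e]| <=
    3 * (#|unmatched E m| + #|unmatched E m'|) + 2 * #|[set e | obstructed E g m m' e]|.
Proof.
pose U := unmatched E m :|: unmatched E m'.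
pose S := [set e | obstructed E g m m' e].
have cU : #|U| <= #|unmatched E m| + #|unmatched E m'|.
  by have [] := leq_card_setU (unmatched E m) (unmatched E m').
have pre (B : {set T}) : #|g @^-1: B| = #|B|.
  rewrite -[g @^-1: _](can2_imset_pre _ (permKV g) (permK g)) card_imset //.
  exact: perm_inj.
have sub : [set e in E | ~~ exchanged g m m' e] \subset
    U :|: (g @^-1: U :|: (g @^-1: (g @^-1: U) :|: (S :|: g @^-1: S))).
  apply/subsetP=> e /setIdP[eE bad]; rewrite !inE !gE eE /=.
  rewrite /obstructed /both_matched !gE eE /=.
  move: bad; rewrite /exchanged; case: mm mm' => mK mE [mK' mE'].
  case: (eqVneq (m e) e) => //= h1; case: (eqVneq (m' e) e) => //= h2.
  case: (eqVneq (m (g e)) (g e)) => //= h3; case: (eqVneq (m' (g e)) (g e)) => //= h4.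
  case: (eqVneq (m (g (g e))) (g (g e))) => //= h5.
  case: (eqVneq (m' (g (g e))) (g (g e))) => //= h6.
  case: (eqVneq (m e) (g e)) => //= h7; case: (eqVneq (m' e) (g e)) => //= h8 h9.
  by rewrite -{1}h7 mK eq_sym h9.
have [h1 _] := leq_card_setU U (g @^-1: U :|: (g @^-1: (g @^-1: U) :|: (S :|: g @^-1: S))).
have [h2 _] := leq_card_setU (g @^-1: U) (g @^-1: (g @^-1: U) :|: (S :|: g @^-1: S)).
have [h3 _] := leq_card_setU (g @^-1: (g @^-1: U)) (S :|: g @^-1: S).
have [h4 _] := leq_card_setU S (g @^-1: S).
rewrite !pre in h1 h2 h3 h4.
have := subset_leq_card sub; rewrite -/S; lia.
Qed.

(** With u and u' unmatched elements, the two cubes have 2^(|E| - (u + u')/2)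
pairs; all elements that are not exchanged are paid for by unmatched elements
or by obstructions. *)
Lemma pair_bound :
  nswaps g (cube E m A) (cube E m' A') ^ kappa * 2 ^ #|[set e in E | ~~ exchanged g m m' e]|
    <= 2 ^ (kappa * #|E|).
Proof.
pose S := [set e | obstructed E g m m' e].
have sS : {in S, forall e, obstructed E g m m' e} by move=> e; rewrite in_set.
have [i [i1 i2]] := avoid_bound A A' mm mm' sS.
have := leq_trans (leq_mul swaps_avoid (leqnn (16 ^ i))) i2.
have := card_bad; move: i1 (card_cube_sqr A mm) (card_cube_sqr A' mm').
set P := nswaps _ _ _; set b := #|S|; set q := #|cube E m A|.
set q' := #|cube E m' A'|; set u := #|unmatched E m|.
set u' := #|unmatched E m'|; set N := #|E|.
move=> i1 hq hq' hb hP.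
have h24 : P ^ 24 * 2 ^ (2 * i) <= (q ^ 2 * q' ^ 2) ^ 12.
  rewrite -(@leq_pmul2r (15 ^ (24 * i))) ?expn_gt0 //.
  apply: (@leq_trans ((P * 16 ^ i) ^ 24)).
    rewrite expnMn -mulnA leq_mul2l -!expnM [i * 24]mulnC !expnM -expnMn mulnC.
    by rewrite leq_expn_base ?pow15_16 ?orbT.
  apply: leq_trans (leq_expn_base 24 hP) _.
  by rewrite expnMn -(expnM 15 i) [i * 24]mulnC mulnC -(expnMn q q' 2) -(expnM (q * q') 2 12).
have h2 : P ^ 24 * 2 ^ (2 * i + 12 * (u + u')) <= 2 ^ (24 * N).
  rewrite expnD mulnA; apply: leq_trans (leq_mul h24 (leqnn _)) _.
  rewrite [12 * _]mulnC expnM -expnMn expnD mulnACA.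
  apply: leq_trans (leq_expn_base 12 (leq_mul hq hq')) _.
  by rewrite -expnD -expnM leq_exp2l //; clear; lia.
have := leq_expn_base 12 h2; rewrite expnMn -!expnM (_ : 24 * N * 12 = kappa * N); last by rewrite /kappa; clear; lia.
apply: leq_trans; rewrite leq_mul2l leq_exp2l //; apply/orP; right.
by clear -i1 hb; lia.
Qed.
End PairBound.

(** * Fibres over the invariant elements *)

Section NormBound.
Variables (T : finType) (E : {set T}) (g : {perm T}) (m m' : T -> T).
Variables (A A' : {set T}).
Hypothesis mm : matching E m.
Hypothesis mm' : matching E m'.
Hypothesis gE : forall e, (g e \in E) = (e \in E).

Let W := [set e in E | g e == e].
Definition fiber (Z : {set {set T}}) (w : {set T}) := [set K in Z | K :&: W == w].

Lemma swaps_fixed K K' e : swaps g K K' -> g e = e -> (e \in K) = (e \in K').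
Proof.
move=> /swapsP /(_ e); rewrite !inE => + ge; rewrite ge.
by case: (e \in K); case: (e \in K').
Qed.

(** Once the trace on [W] is fixed, a pair that meets [W] carries no free bit. *)
Definition restricted (mu : T -> T) e := if (e \in W) || (mu e \in W) then e else mu e.

Lemma restricted_matching mu : matching E mu -> matching (E :\: W) (restricted mu).
Proof.
move=> [muK muE]; split=> e.
  rewrite {2}/restricted; case: ifP => h; rewrite /restricted; first by rewrite h.
  by rewrite muK orbC h.
move=> /setDP[eE eW]; rewrite /restricted (negbTE eW) /=.
by case: ifP => [_|/negbT h]; rewrite in_setD ?eE ?eW ?h ?muE.
Qed.

Lemma restricted_cube mu B K0 K : matching E mu ->
  K0 \in cube E mu B -> K \in cube E mu B -> K :&: W = K0 :&: W ->
  K :\: W \in cube (E :\: W) (restricted mu) K0.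
Proof.
move=> [muK muE] /cubeP[s0 h0] /cubeP[s h] /setP eqW; apply/cubeP; split.
  by apply: setSD.
move=> e /setDP[eE eW]; rewrite in_setD eW /= /restricted (negbTE eW) /=.
have eqe x : x \in W -> (x \in K) = (x \in K0).
  by move=> xW; have := eqW x; rewrite !in_setI xW !andbT.
case: (boolP (mu e \in W)) => mW.
  rewrite eqxx (h _ eE) (h0 _ eE); case: ifP => // _; by rewrite eqe.
rewrite (h _ eE); case: eqVneq => me; last by rewrite in_setD mW.
by rewrite (h0 _ eE) me eqxx.
Qed.

Lemma fiber_bound (X Y : {set {set T}}) w :
  X \subset cube E m A -> Y \subset cube E m' A' ->
  nswaps g (fiber X w) (fiber Y w) ^ kappa
      * 2 ^ #|[set e in E :\: W | ~~ exchanged g m m' e]|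
    <= 2 ^ (kappa * #|E :\: W|).
Proof.
move=> sX sY; set X' := fiber X w; set Y' := fiber Y w.
have [X0|[K0 K0X]] := set_0Vmem X'.
  by have := nswaps_le g X' Y'; rewrite X0 cards0 leqn0 => /eqP ->; rewrite exp0n // expn_gt0.
have [Y0|[K1 K1Y]] := set_0Vmem Y'.
  by have := nswaps_le g X' Y'; rewrite Y0 cards0 muln0 leqn0 => /eqP ->; rewrite exp0n // expn_gt0.
have gW e : (g e \in E :\: W) = (e \in E :\: W).
  by rewrite !inE !gE (inj_eq perm_inj).
have := pair_bound K0 K1 (restricted_matching mm) (restricted_matching mm') gW.
apply: leq_trans; apply: leq_mul; last first.
  rewrite leq_exp2l // subset_leq_card //; apply/subsetP=> e.
  rewrite !inE => /andP[-> /=]; apply: contra => /and4P[h1 /eqP h2 /eqP h3 h4].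
  have hr mu : restricted mu e != e -> restricted mu e = mu e.
    by rewrite /restricted; case: ifP; rewrite ?eqxx.
  have h5 : restricted m' e != e by rewrite h3 -h2.
  by rewrite /exchanged -(hr _ h1) -(hr _ h5) h1 h2 h3 eqxx.
apply: leq_expn_base.
pose f (p : {set T} * {set T}) := (p.1 :\: W, p.2 :\: W).
have fI : {in [set p | [&& p.1 \in X', p.2 \in Y' & swaps g p.1 p.2]] &, injective f}.
  have wI (K K' : {set T}) : K :&: W == w -> K' :&: W == w ->
      K :\: W = K' :\: W -> K = K'.
    by move=> /eqP h1 /eqP h2 h; rewrite -(setID K W) -(setID K' W) h h1 h2.
  case=> K1' K2' [L1 L2]; rewrite !in_set /= => /and3P[/andP[_ a1] /andP[_ a2] _].
  by move=> /and3P[/andP[_ b1] /andP[_ b2] _] [/(wI _ _ a1 b1) -> /(wI _ _ a2 b2) ->].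
rewrite /nswaps -(card_in_imset fI) subset_leq_card //.
apply/subsetP=> _ /imsetP[[K K'] + ->]; rewrite in_set => /and3P[/= kX kY sw]; rewrite in_set /=.
case/setIdP: kX => kX /eqP kw; case/setIdP: kY => kY /eqP kw'.
case/setIdP: K0X => k0X /eqP k0w; case/setIdP: K1Y => k1Y /eqP k1w.
rewrite (restricted_cube mm (subsetP sX _ k0X) (subsetP sX _ kX)) ?kw //=.
rewrite (restricted_cube mm' (subsetP sY _ k1Y) (subsetP sY _ kY)) ?kw' //=.
have eqD (L L' : {set T}) : L :&: W = w -> L' :&: W = w -> (L :\: W) :\: (L' :\: W) = L :\: L'.
  move=> h1 h2; apply/setP=> e; rewrite !in_setD.
  have := congr1 (fun S : {set T} => e \in S) (etrans h1 (esym h2)).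
  rewrite !in_setI; case: (e \in W); rewrite ?andbT //= => ->.
  by rewrite andNb.
by rewrite /swaps !eqD.
Qed.

(** Related sets have the same trace on [W], so that the related pairs split into
fibres over this trace; each fibre is bounded by [pair_bound] outside [W], and
Cauchy-Schwarz adds them up. The factor 2^(|W|/2) gained in this way is
needed because [f_r r n] is smaller than |E|/2 by half a number of invariant
edges, which for graphs is of the order of a vertex degree. *)
Lemma norm_bound (X Y : {set {set T}}) :
  X \subset cube E m A -> Y \subset cube E m' A' ->
  nswaps g X Y ^ (2 * kappa) * 2 ^ #|[set e in E :\: W | ~~ exchanged g m m' e]|
    <= (#|X| * #|Y|) ^ kappa * 2 ^ (kappa * #|E :\: W|).
Proof.
move=> sX sY; set b := #|[set e in _ | _]|.
pose x w := #|fiber X w|; pose y w := #|fiber Y w|.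
pose e w := nswaps g (fiber X w) (fiber Y w); pose P := \max_w e w.
have sume : nswaps g X Y = \sum_w e w.
  rewrite /nswaps (card_fibers (fun p => p.1 :&: W)); apply: eq_bigr => w _.
  congr #|pred_of_set _|; apply/setP=> -[K K']; rewrite !in_set /=.
  case: (K \in X); case: (K' \in Y) => //=; rewrite ?andbF //.
  case: (boolP (swaps g K K')) => sw; rewrite ?andbF // !andbT.
  suff -> : K' :&: W = K :&: W by rewrite andbb.
  apply/setP=> a; rewrite !in_setI [a \in W]in_set.
  case: (a \in E); rewrite ?andbF //=; case: eqP; rewrite ?andbF // => ga.
  by rewrite !andbT (swaps_fixed sw ga).
have sumx : #|X| = \sum_w x w by rewrite (card_fibers (fun K => K :&: W)).
have sumy : #|Y| = \sum_w y w by rewrite (card_fibers (fun K => K :&: W)).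
have hP : P ^ kappa * 2 ^ b <= 2 ^ (kappa * #|E :\: W|).
  have ne : 0 < #|{: {set T}}| by apply/card_gt0P; exists set0.
  by have [w0 eP] := eq_bigmax e ne; rewrite /P eP; apply: fiber_bound.
have h2 : nswaps g X Y ^ 2 <= #|X| * #|Y| * P.
  rewrite sume sumx sumy; apply: cauchy_nat => w; rewrite expnS expn1.
  by apply: leq_mul; [exact: nswaps_le | exact: leq_bigmax].
rewrite expnM; apply: leq_trans (leq_mul (leq_expn_base kappa h2) (leqnn _)) _.
by rewrite expnMn -mulnA leq_mul2l hP orbT.
Qed.
End NormBound.

(** * Permutations of the vertices acting on edges *)

Section Reach.
Variables (T : finType) (E : {set T}) (g : {perm T}) (K0 : {set T}).
Hypothesis gE : forall e, (g e \in E) = (e \in E).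

(** In a set related to [K0] by [g], an element [e] of [departing] is either kept
or replaced by [g e], and nothing else can change. *)
Definition departing := [set e in K0 | g e \notin K0].
Definition reach_matching e :=
  if e \in departing then g e else if (g^-1)%g e \in departing then (g^-1)%g e else e.

Lemma reach_matchingP : matching E reach_matching.
Proof.
split=> e; rewrite /reach_matching.
  case: (boolP (e \in departing)) => h1.
    have -> : g e \in departing = false by case/setIdP: h1 => _ /negbTE; rewrite inE => ->.
    by rewrite permK h1.
  case: (boolP ((g^-1)%g e \in departing)) => h2; first by rewrite h2 permKV.
  by rewrite (negbTE h1) (negbTE h2).
case: ifP => _ eE; first by rewrite gE.
by case: ifP => // _; rewrite -gE permKV.
Qed.

Lemma reach_cube (K : {set T}) : K0 \subset E -> K \subset E -> swaps g K0 K ->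
  K \in cube E reach_matching K0.
Proof.
move=> s0 s /swapsP sw; apply/cubeP; split=> // e eE.
have := sw e; have := sw ((g^-1)%g e); rewrite permKV /reach_matching !inE permKV.
case: (eqVneq (g e) e) => [ge|ge].
  have -> : (g^-1)%g e = e by rewrite -{1}ge permK.
  by rewrite ge; case: (e \in K0); case: (e \in K) => //=; rewrite ?eqxx.
have ge' : (g^-1)%g e != e by apply: contraNneq ge => {1}<-; rewrite permKV.
case e0: (e \in K0); case ek: (e \in K); case ge0: (g e \in K0); case gek: (g e \in K);
 case gi0: ((g^-1)%g e \in K0); case gik: ((g^-1)%g e \in K); rewrite ?eqxx ?(negbTE ge) ?(negbTE ge') //= ?e0 ?ek ?gek ?gik //.
Qed.

End Reach.

Section Action.
Variable n : nat.
Implicit Types (s t : {perm 'I_n}) (e : {set 'I_n}).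

Definition edge_perm s : {perm {set 'I_n}} := perm (imset_inj (@perm_inj _ s)).

Lemma edge_permE s e : edge_perm s e = s @: e. Proof. by rewrite permE. Qed.

Lemma edge_perm_fixP s e : reflect (forall x, x \in e -> s x \in e) (edge_perm s e == e).
Proof.
rewrite edge_permE; apply: (iffP eqP) => [{2}<- x xe|h]; first exact: imset_f.
apply/eqP; rewrite eqEcard card_imset ?leqnn ?andbT; last exact: perm_inj.
by apply/subsetP=> _ /imsetP[x xe ->]; apply: h.
Qed.

Lemma edge_perm_fix s e x : edge_perm s e = e -> (s x \in e) = (x \in e).
Proof. by move=> {1}<-; rewrite edge_permE mem_imset //; apply: perm_inj. Qed.

Lemma edge_permM s t e : edge_perm (s * t)%g e = edge_perm t (edge_perm s e).
Proof.
by rewrite !edge_permE -imset_comp; apply: eq_imset => x; rewrite /= permM.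
Qed.

Definition edges r : {set {set 'I_n}} := [set e : {set 'I_n} | #|e| == r].

Lemma card_edges r : #|edges r| = 'C(n, r).
Proof. by rewrite /edges card_draws card_ord. Qed.

Lemma edge_perm_edges r s e : (edge_perm s e \in edges r) = (e \in edges r).
Proof. by rewrite !inE edge_permE card_imset //; apply: perm_inj. Qed.

Lemma isomorphicE (G H : hypergraph n) :
  isomorphic (G :\: H) (H :\: G) = [exists s, swaps (edge_perm s) G H].
Proof.
apply: eq_existsb => s; congr (_ == _); apply: eq_imset => e; exact/esym/edge_permE.
Qed.

Definition moved s : {set 'I_n} := [set x | s x != x].
Definition shifted r s : {set {set 'I_n}} := [set e in edges r | edge_perm s e != e].
(** These edges are moved by any permutation that sends [x] to [y]. *)
Definition star r x y : {set {set 'I_n}} :=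
  [set e in edges r | (x \in e) && (y \notin e)].

Lemma card_star r x y : 0 < r -> x != y -> 'C(n - 2, r.-1) <= #|star r x y|.
Proof.
move=> r0 xy; pose B := ~: [set x; y].
have cB : #|B| = n - 2 by have := cardsC [set x; y]; rewrite cards2 xy card_ord /B; lia.
rewrite -cB -cards_draws.
have xB (S : {set 'I_n}) : S \subset B -> x \notin S.
  by move=> /subsetP sB; apply/negP=> /sB; rewrite !inE eqxx.
have yB (S : {set 'I_n}) : S \subset B -> y \notin S.
  by move=> /subsetP sB; apply/negP=> /sB; rewrite !inE eqxx orbT.
rewrite -(@card_in_imset _ _ (fun S => x |: S)).
  apply/subset_leq_card/subsetP=> _ /imsetP[S /setIdP[sS /eqP cS] ->].
  rewrite !inE eqxx cardsU1 (xB _ sS) cS add1n prednK // eqxx /=.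
  by rewrite (negbTE (yB _ sS)) orbF eq_sym.
move=> S1 S2 /setIdP[s1 _] /setIdP[s2 _] eqS.
by rewrite -(setU1K (xB _ s1)) eqS setU1K // xB.
Qed.

Lemma star_shifted r s x : star r x (s x) \subset shifted r s.
Proof.
apply/subsetP=> e /setIdP[eE /andP[xe sxe]]; rewrite inE eE /=.
by apply: contra sxe => /eqP h; rewrite (edge_perm_fix _ h).
Qed.

(** Count the pairs of a moved vertex [x] and an edge in [star r x (s x)]. *)
Lemma card_moved r s : 0 < r ->
  #|moved s| * 'C(n - 2, r.-1) <= r * #|shifted r s|.
Proof.
move=> r0; apply: (@leq_trans (\sum_(x in moved s) #|star r x (s x)|)).
  rewrite -sum_nat_const; apply: leq_sum => x; rewrite inE eq_sym.
  exact: card_star.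
have -> : \sum_(x in moved s) #|star r x (s x)| =
    \sum_(x in moved s) \sum_(e in shifted r s) (e \in star r x (s x)).
  apply: eq_bigr => x _; rewrite -sum1_card big_mkcond [RHS]big_mkcond /=.
  apply: eq_bigr => e _; case: ifP => [/(subsetP (star_shifted _ _ _)) ->//|_].
  by case: ifP.
rewrite exchange_big mulnC -sum_nat_const; apply: leq_sum => e /setIdP[eE _].
have <- : #|e| = r by apply/eqP; move: eE; rewrite inE.
rewrite -sum1_card big_mkcond [X in _ <= X]big_mkcond /=; apply: leq_sum => x _.
case: ifP => // _; rewrite inE; case: (e \in _) => //=.
by case: (x \in e) => //=; apply: leq_b1.
Qed.

(** For a moved [x], the edges through [x] that avoid [s x] and the edges through
[s^-1 x] that avoid [x] are disjoint families. For graphs the factor 2 is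
essential, because twice the number of invariant edges of an optimal
involution exceeds ['C(n - 2, r.-1)]. *)
Lemma card_shifted_neq1 r s : 0 < r -> s != 1%g ->
  2 * 'C(n - 2, r.-1) <= #|shifted r s|.
Proof.
move=> r0 s1; have [x sx] : exists x, s x != x.
  apply/existsP; apply: contraNT s1 => /existsPn h.
  by apply/eqP/permP=> x; rewrite perm1; apply/eqP; rewrite -[_ == _]negbK h.
pose y := (s^-1)%g x; have sy : s y = x by rewrite permKV.
have yx : y != x by apply: contraNneq sx => yx; rewrite -{1}yx sy.
have dis : star r x (s x) :&: star r y (s y) = set0.
  by apply/setP=> e; rewrite !inE sy; case: (x \in e); rewrite ?andbF.
have : star r x (s x) :|: star r y (s y) \subset shifted r s.
  by rewrite subUset !star_shifted.
move/subset_leq_card; rewrite cardsU dis cards0 subn0; apply: leq_trans.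
by rewrite mul2n -addnn leq_add // card_star // ?sy // eq_sym.
Qed.

End Action.

(** * Invariant edges of involutions *)

Section Involution.
Variable n : nat.
Implicit Types (s t : {perm 'I_n}) (e : {set 'I_n}).

Definition fixpoints s : {set 'I_n} := [set x | s x == x].
Definition fixedges r s : {set {set 'I_n}} := [set e in edges n r | edge_perm s e == e].

(** Turning two fixed points into a 2-cycle can only destroy invariant edges. *)
Lemma merge_fixpoints s p q : (forall x, s (s x) = x) ->
  p != q -> s p = p -> s q = q ->
  exists t, [/\ forall x, t (t x) = x, t p = q,
    fixpoints t \proper fixpoints s & forall e, edge_perm t e == e -> edge_perm s e == e].
Proof.
move=> inv pq sp sq; pose t := (s * tperm p q)%g; exists t.
have tp : t p = q by rewrite permM sp tpermL.
have tq : t q = p by rewrite permM sq tpermR.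
have tx x : x != p -> x != q -> t x = s x.
  move=> xp xq; rewrite permM tpermD // eq_sym.
    by apply: contraNneq xp => h; rewrite -(inv x) h sp.
  by apply: contraNneq xq => h; rewrite -(inv x) h sq.
split=> //.
- move=> x; have [->|xp] := eqVneq x p; first by rewrite tp tq.
  have [->|xq] := eqVneq x q; first by rewrite tq tp.
  rewrite (tx x) // tx //.
    by apply: contraNneq xp => h; rewrite -(inv x) h sp.
  by apply: contraNneq xq => h; rewrite -(inv x) h sq.
- rewrite properE; apply/andP; split; last first.
    by apply/subsetPn; exists p; rewrite inE ?sp // tp eq_sym.
  apply/subsetP=> x; rewrite !inE.
  have [->|xp] := eqVneq x p; first by rewrite sp eqxx.
  have [->|xq] := eqVneq x q; first by rewrite sq eqxx.
  by rewrite tx.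
move=> e /edge_perm_fixP h; apply/edge_perm_fixP=> x xe.
have [eqx|xp] := eqVneq x p; first by rewrite eqx sp -eqx.
have [eqx|xq] := eqVneq x q; first by rewrite eqx sq -eqx.
by rewrite -tx // h.
Qed.

Lemma refine_involution s : (forall x, s (s x) = x) ->
  exists t, [/\ forall x, t (t x) = x, #|fixpoints t| <= 1
    & forall e, edge_perm t e == e -> edge_perm s e == e].
Proof.
have [k] := ubnP #|fixpoints s|; elim: k s => // k IH s lek inv.
have [le1|] := leqP #|fixpoints s| 1; first by exists s.
case/card_gt1P=> p [q [pF qF pq]].
have sp : s p = p by apply/eqP; move: pF; rewrite inE.
have sq : s q = q by apply/eqP; move: qF; rewrite inE.
have [t [invt _ lt sub]] := merge_fixpoints inv pq sp sq.
case: (IH t) => [||u [u1 u2 u3]] //.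
  by apply: leq_trans (proper_card lt) _; rewrite -ltnS.
by exists u; split=> // e /u3/sub.
Qed.

Lemma card_half s : (forall x, s (s x) = x) -> #|fixpoints s| <= 1 ->
  #|fixpoints s| = odd n /\ #|reps [set: 'I_n] s| = n./2.
Proof.
move=> inv le1; have := @card_reps _ [set: 'I_n] s (conj inv (fun _ _ => in_setT _)).
have -> : unmatched [set: 'I_n] s = fixpoints s by apply/setP=> x; rewrite !inE.
rewrite cardsT card_ord => h; have := odd_double_half n; lia.
Qed.

(** An invariant edge is determined by the representatives of its 2-cycles. *)
Definition half_edge s r (A : {set 'I_n}) : {set 'I_n} :=
  A :|: s @: A :|: (if odd r then fixpoints s else set0).

Lemma reps_half_edge s r (A : {set 'I_n}) : (forall x, s (s x) = x) ->
  A \subset reps [set: 'I_n] s -> half_edge s r A :&: reps [set: 'I_n] s = A.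
Proof.
move=> inv sA; apply/setP=> x; rewrite !inE /=.
have -> : (x \in if odd r then fixpoints s else set0) = odd r && (s x == x).
  by case: (odd r); rewrite inE.
rewrite -{2}(inv x) mem_imset; last exact: perm_inj.
have := subsetP sA x; have := subsetP sA (s x); rewrite !inE inv /=.
case: (x \in A) => [_ -> //|] /=; case: (s x \in A) => /= [|_ _].
  by move=> /(_ isT) h _; rewrite ltnNge (ltnW h).
by case: eqP => [->|]; rewrite ?ltnn ?andbF.
Qed.

Lemma fixedges_reps s r e : (forall x, s (s x) = x) -> #|fixpoints s| <= 1 ->
  e \in fixedges r s -> [/\ #|e :&: reps [set: 'I_n] s| = r./2,
    odd r -> odd n & half_edge s r (e :&: reps [set: 'I_n] s) = e].
Proof.
move=> inv le1 /setIdP[]; rewrite inE => /eqP er /eqP fe.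
have me : matching e s by split=> // x; rewrite (edge_perm_fix _ fe).
have := card_reps me; have [fx hx] := card_half inv le1.
have -> : reps e s = e :&: reps [set: 'I_n] s by apply/setP=> x; rewrite !inE.
have eu : unmatched e s = e :&: fixpoints s by apply/setP=> x; rewrite !inE.
have : #|e :&: fixpoints s| <= #|fixpoints s| by rewrite subset_leq_card ?subsetIr.
rewrite eu er => lef hr; have := odd_double_half r => hr2.
have cf : #|e :&: fixpoints s| = odd r by lia.
split; [lia|by move=> ro; move: lef; rewrite cf fx ro; case: (odd n)|].
apply/setP=> x; rewrite /half_edge !inE /=.
have -> : (x \in if odd r then fixpoints s else set0) = (x \in e :&: fixpoints s).
  move: cf; case: (odd r) => cf.
    have -> // : e :&: fixpoints s = fixpoints s.
    by apply/eqP; rewrite eqEcard subsetIr cf.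
  by have /eqP := cf; rewrite cards_eq0 => /eqP ->.
rewrite -[x in x \in s @: _](inv x) mem_imset; last exact: perm_inj.
rewrite !inE inv /= (edge_perm_fix _ fe).
case: (x \in e) => //=; case: eqP => [->|]; rewrite ?orbT //.
rewrite orbF => h; have : enum_rank x != enum_rank (s x).
  by apply/eqP=> /enum_rank_inj /esym.
by rewrite -val_eqE /= neq_ltn.
Qed.

Lemma card_fixedges_min s r : (forall x, s (s x) = x) -> #|fixpoints s| <= 1 ->
  #|fixedges r s| = if odd r && ~~ odd n then 0 else 'C(n./2, r./2).
Proof.
move=> inv le1; have [fx hx] := card_half inv le1.
case: ifP => [/andP[ro ne]|par].
  apply/eqP; rewrite cards_eq0; apply/eqP/setP=> e; rewrite [RHS]inE.
  apply/negP=> /(fixedges_reps inv le1)[_ /(_ ro)]; by rewrite (negbTE ne).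
have hodd : odd r -> #|fixpoints s| = 1.
  by move=> ro; rewrite fx; move: par; rewrite ro; case: (odd n).
rewrite -hx -cards_draws.
pose D := [set A : {set 'I_n} | A \subset reps [set: 'I_n] s & #|A| == r./2].
have inj : {in D &, injective (half_edge s r)}.
  move=> A B /setIdP[sA _] /setIdP[sB _] h.
  by rewrite -(reps_half_edge r inv sA) h reps_half_edge.
rewrite -/D -(card_in_imset inj); congr #|pred_of_set _|; apply/setP=> e.
apply/idP/imsetP=> [eF|[A /setIdP[sA /eqP cA] ->]].
  have [h1 h2 h3] := fixedges_reps inv le1 eF.
  by exists (e :&: reps [set: 'I_n] s); rewrite // inE subsetIr h1 eqxx.
have fixH : edge_perm s (half_edge s r A) = half_edge s r A.
  apply/eqP/edge_perm_fixP=> x; rewrite !in_setU => /orP[/orP[xA|/imsetP[y yA ->]]|xF].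
  - by rewrite imset_f ?orbT.
  - by rewrite inv yA.
  have /eqP -> : s x == x by move: xF; case: (odd r); rewrite inE.
  by rewrite xF orbT.
rewrite inE fixH eqxx andbT inE.
have me : matching (half_edge s r A) s by split=> // x; rewrite (edge_perm_fix _ fixH).
rewrite -(card_reps me).
have -> : reps (half_edge s r A) s = A.
  by rewrite -[RHS](reps_half_edge r inv sA); apply/setP=> x; rewrite !inE.
have -> : unmatched (half_edge s r A) s = if odd r then fixpoints s else set0.
  apply/setP=> x; rewrite in_set; apply/andP/idP => [[]|xF].
    rewrite /half_edge !in_setU => /orP[/orP[xA|/imsetP[y yA xy]]|//] sx.
      by have := subsetP sA _ xA; rewrite !inE (eqP sx) ltnn.
    move: sx; rewrite xy inv => /eqP ysy.
    by have := subsetP sA _ yA; rewrite !inE -ysy ltnn.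
  by rewrite /half_edge in_setU xF orbT; move: xF; case: (odd r); rewrite inE.
rewrite cA; have := odd_double_half r; move: hodd.
case: (odd r) => /= [->|_]; rewrite ?cards0 //; lia.
Qed.

(** The least number of invariant edges of an involution. *)
Definition defect r : nat := if odd r && ~~ odd n then 0 else 'C(n./2, r./2).

Lemma f_r_defect r : 2 * f_r r n + defect r = 'C(n, r).
Proof. by rewrite mul2n f_r_exact. Qed.

Lemma defect_involution r s : (forall x, s (s x) = x) -> defect r <= #|fixedges r s|.
Proof.
move=> /refine_involution[t [inv le1 sub]].
rewrite /defect -(card_fixedges_min r inv le1); apply/subset_leq_card/subsetP=> e.
by rewrite !inE => /andP[-> /sub].
Qed.

(** Otherwise choose [r] fixed points [e], one of them [p], and a fixed point [q]
outside. Merging [p] and [q] destroys the invariant edge [e]. *)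
Lemma few_fixpoints r s : 0 < r -> (forall x, s (s x) = x) ->
  #|fixedges r s| <= defect r -> #|fixpoints s| <= r.
Proof.
move=> r0 inv le; rewrite leqNgt; apply/negP=> many.
move: le; rewrite leqNgt => /negP; apply.
have [e] : exists e, e \in [set e : {set 'I_n} | e \subset fixpoints s & #|e| == r].
  by apply/card_gt0P; rewrite cards_draws bin_gt0 ltnW.
rewrite inE => /andP[eF /eqP ce].
have [p pe] : exists p, p \in e by apply/card_gt0P; rewrite ce.
have [q qF qe] : exists2 q, q \in fixpoints s & q \notin e.
  by apply/subsetPn; apply/negP=> /subset_leq_card; rewrite ce leqNgt many.
have fixed x : x \in fixpoints s -> s x = x by rewrite inE => /eqP.
have pq : p != q by apply: contraNneq qe => <-.
have [t [invt tp _ sub]] := merge_fixpoints inv pq (fixed _ (subsetP eF _ pe)) (fixed _ qF).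
apply: leq_ltn_trans (defect_involution r invt) _; apply: proper_card.
rewrite properE; apply/andP; split.
  by apply/subsetP=> f; rewrite !inE => /andP[-> /sub].
apply/subsetPn; exists e.
  rewrite !inE ce eqxx; apply/edge_perm_fixP=> x xe; by rewrite fixed // (subsetP eF).
rewrite inE negb_and; apply/orP; right; apply/negP=> /edge_perm_fixP/(_ _ pe).
by rewrite tp (negbTE qe).
Qed.

(** Vertices in 2-cycles and fixed points are handled separately: a 2-cycle is an
invariant edge, and joining one fixed point [o] to the others gives enough
invariant edges for the fixed points. *)
Lemma fixedges2 s : n <= 2 * #|fixedges 2 s| + #|moved (s * s)%g| + 1.
Proof.
pose Gd := ~: moved (s * s)%g; pose m x := if s (s x) == x then s x else x.
have GdP x : (x \in Gd) = (s (s x) == x) by rewrite !inE permM negbK.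
have mm : matching Gd m.
  split=> x; rewrite ?GdP /m; last by case: eqP => // ->; rewrite eqxx.
  have [h|/negbTE h] /= := eqVneq (s (s x)) x; last by rewrite h.
  by rewrite h eqxx.
have := card_reps mm; have := cardsC (moved (s * s)%g); rewrite -/Gd card_ord.
set R := reps Gd m; set U := unmatched Gd m => c1 c2.
have RP x : x \in R -> s (s x) = x /\ enum_rank x < enum_rank (s x).
  by rewrite inE GdP /m => /andP[/eqP h]; rewrite h eqxx => h2.
have UP x : x \in U -> s x = x.
  by rewrite inE GdP /m => /andP[/eqP h]; rewrite h eqxx => /eqP.
pose P1 := (fun x => [set x; s x]) @: R.
have cP1 : #|P1| = #|R|.
  apply: card_in_imset => x y /RP[h1 h2] /RP[h3 h4] /setP eqxy.
  have := eqxy x; rewrite !inE eqxx /= => /esym/orP[/eqP //|/eqP xy].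
  have := eqxy y; rewrite !inE eqxx /= => /orP[/eqP //|/eqP yx].
  by move: h2 h4; rewrite -yx -xy => h2 /(ltn_trans h2); rewrite ltnn.
have P1F : P1 \subset fixedges 2 s.
  apply/subsetP=> _ /imsetP[x /RP[h1 h2] ->]; rewrite !inE cards2.
  have -> : x != s x by apply: contraTneq h2 => <-; rewrite ltnn.
  rewrite eqxx /=; apply/edge_perm_fixP=> y; rewrite !inE.
  by case/orP=> /eqP ->; rewrite ?h1 eqxx ?orbT.
have [U0|[o oU]] := set_0Vmem U.
  have := subset_leq_card P1F; rewrite cP1; move: c2; rewrite U0 cards0.
  by move: c1; move: #|R| #|Gd| #|moved _| #|fixedges _ _| => ? ? ? ?; lia.
pose P2 := (fun x => [set o; x]) @: (U :\ o).
have cP2 : #|P2| = #|U| - 1.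
  rewrite (cardsD1 o U) oU add1n subn1 /=; apply: card_in_imset => x y.
  move=> /setD1P[xo _] /setD1P[yo _] /setP/(_ x).
  by rewrite !inE eqxx orbT (negbTE xo) => /esym/eqP.
have P2F : P2 \subset fixedges 2 s.
  apply/subsetP=> _ /imsetP[x /setD1P[xo xU] ->]; rewrite !inE cards2 (eq_sym o) xo /=.
  apply/edge_perm_fixP=> y; rewrite !inE.
  by case/orP=> /eqP ->; rewrite (UP o oU, UP x xU) eqxx ?orbT.
have dis : P1 :&: P2 = set0.
  apply/setP=> e; rewrite in_setI [RHS]inE; apply/negP=> /andP[].
  case/imsetP=> x /RP[h1 h2] -> /imsetP[y /setD1P[yo yU] /setP/(_ x)].
  by rewrite !inE eqxx /= => /esym/orP[] /eqP xy; move: h2; rewrite xy UP ?ltnn.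
have : P1 :|: P2 \subset fixedges 2 s by rewrite subUset P1F P2F.
have : 0 < #|U| by apply/card_gt0P; exists o.
move=> u0 /subset_leq_card; rewrite cardsU dis cards0 subn0 cP1 cP2.
by move: c1 c2 u0; move: #|R| #|U| #|Gd| #|moved _| #|fixedges _ _| => ? ? ? ? ?; lia.
Qed.

(** For graphs this is [fixedges2]. For [r > 2] a single vertex of a longer cycle
is enough, as [r./2 <= r - 2]. *)
Lemma defect_le r s : 1 < r ->
  defect r <= #|fixedges r s| + #|moved (s * s)%g| * n ^ (r - 2).
Proof.
move=> r1; have [t0|t_gt0] := posnP #|moved (s * s)%g|.
  rewrite t0 mul0n addn0; apply: defect_involution => x.
  have := in_set0 x; move/eqP: t0; rewrite cards_eq0 => /eqP <-.
  by rewrite inE permM => /negbFE/eqP.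
have [->|r2] := eqVneq r 2.
  have := fixedges2 s; rewrite /defect /= bin1 expn0; have := odd_double_half n; lia.
apply: leq_trans (leq_addl _ _); apply: (@leq_trans (n ^ (r - 2))); last by rewrite leq_pmull.
rewrite /defect; case: ifP => // _; apply: leq_trans (bin_leq_exp _ _) _.
have hr := odd_double_half r.
have [->|n0] := posnP n; first by rewrite (_ : 0./2 = 0) // !exp0n //; lia.
apply: (@leq_trans (n ^ r./2)); first by rewrite leq_expn_base //; have := odd_double_half n; lia.
rewrite leq_pexp2l //; lia.
Qed.

Definition ball (s0 : {perm 'I_n}) D : {set {perm 'I_n}} :=
  [set s | #|moved (s * s0^-1)%g| <= D].

(** A permutation in the ball is determined by a list of [D] vertices containing
all those where it differs from [s0], together with their images. *)
Lemma card_ball (s0 : {perm 'I_n}) D : 0 < n -> #|ball s0 D| <= n ^ (2 * D).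
Proof.
move=> n0; pose x0 := Ordinal n0; pose mv (s : {perm 'I_n}) := moved (s * s0^-1)%g.
pose f (s : {perm 'I_n}) : {ffun 'I_D -> 'I_n * 'I_n} :=
  [ffun i : 'I_D => let x := nth x0 (enum (mv s)) i in (x, s x)].
have mvP (s : {perm 'I_n}) x : x \notin mv s -> s x = s0 x.
  by rewrite inE permM negbK => /eqP {2}<-; rewrite permKV.
have half (s t : {perm 'I_n}) x : s \in ball s0 D -> f s = f t -> x \in mv s -> s x = t x.
  rewrite inE -/(mv s) => sD /ffunP fst xs.
  have xD : index x (enum (mv s)) < D.
    by apply: leq_trans sD; rewrite cardE index_mem mem_enum.
  have := fst (Ordinal xD); rewrite !ffunE /= nth_index ?mem_enum // => -[xy].
  by rewrite -xy.
have fI : {in ball s0 D &, injective f}.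
  move=> s t sD tD fst; apply/permP=> x.
  have [xs|/mvP xs] := boolP (x \in mv s); first exact: half.
  have [xt|/mvP xt] := boolP (x \in mv t); last by rewrite xs xt.
  by apply/esym; apply: half => //; rewrite fst.
rewrite -(card_in_imset fI); apply: leq_trans (max_card _) _.
by rewrite card_ffun card_prod !card_ord expnM mulnn.
Qed.

End Involution.

(** * Permutations that relate many pairs *)

Section Important.
Variables (n r : nat).
Hypothesis r1 : 1 < r.
Let E := edges n r.
Let beta := 'C(n - 2, r.-1).
Implicit Types (s : {perm 'I_n}) (X Y : {set {set {set 'I_n}}}).

(** The edges where [s] contradicts the matching [m]; invariant edges are counted
separately. *)
Definition misfit s (m : {set 'I_n} -> {set 'I_n}) : {set {set 'I_n}} :=
  [set e in E | (edge_perm s e != e) && (m e != edge_perm s e)].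

(** [norm_bound] in logarithmic form, for a permutation that relates a fraction
2^(-l) of the pairs of two sets of size about 2^(f_r r n). *)
Lemma important_bound s m m' A A' X Y l :
  matching E m -> matching E m' -> X \subset cube E m A -> Y \subset cube E m' A' ->
  #|X| * #|Y| <= 2 ^ l * nswaps (edge_perm s) X Y ->
  2 ^ (2 * f_r r n) <= #|X| * #|Y| * 2 ^ (2 * l) ->
  #|[set e in E :\: fixedges r s | ~~ exchanged (edge_perm s) m m' e]| + kappa * #|fixedges r s|
    <= kappa * (4 * l + defect n r).
Proof.
move=> mm mm' sX sY h1 h2.
have := norm_bound mm mm' (edge_perm_edges r s) sX sY.
rewrite -/(fixedges r s); set b := #|[set e in _ | _]|; set p := #|X| * #|Y|.
set ns := nswaps _ _ _; set W := fixedges r s => hn.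
have p0 : 0 < p by case: (posnP p) => // p0; move: h2; rewrite -/p p0 mul0n leqNgt expn_gt0.
have hW : #|E :\: W| + #|W| = 2 * f_r r n + defect n r.
  rewrite f_r_defect -card_edges addnC -(cardsID W E); congr (_ + _).
  by congr #|pred_of_set _|; apply/esym/setIidPr/subsetP=> e /setIdP[].
have h3 : p ^ kappa * 2 ^ b <= 2 ^ (kappa * (2 * l + #|E :\: W|)).
  rewrite -(@leq_pmul2l (p ^ kappa)) ?expn_gt0 ?p0 // mulnA -expnD addnn -mul2n.
  apply: leq_trans (leq_mul (leq_expn_base (2 * kappa) h1) (leqnn _)) _.
  rewrite expnMn -mulnA; apply: leq_trans (leq_mul (leqnn _) hn) _.
  rewrite -expnM mulnCA -expnD leq_mul2l leq_exp2l //; apply/orP; right.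
  by clear; move: kappa #|_| => k a; nia.
have h4 : 2 ^ (kappa * (2 * f_r r n) + b) <= 2 ^ (kappa * (4 * l + #|E :\: W|)).
  rewrite expnD (mulnC kappa (2 * _)) expnM.
  apply: leq_trans (leq_mul (leq_expn_base kappa h2) (leqnn _)) _.
  rewrite expnMn mulnAC; apply: leq_trans (leq_mul h3 (leqnn _)) _.
  rewrite -expnM -expnD leq_exp2l // (mulnC _ kappa) -mulnDr leq_mul2l; apply/orP; right.
  by clear; lia.
rewrite leq_exp2l // in h4; clear -h4 hW.
move: kappa h4 => k h4; nia.
Qed.

Hypothesis degree_large : 2 * r * kappa * n ^ (r - 2) <= beta.

(** A permutation whose square moves t points has at most t * n^(r-2) invariant
edges fewer than an optimal involution, but it fails to exchange at least
t * beta / r edges; the second number prevails by [degree_large]. *)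
Lemma important_facts s m m' A A' X Y l :
  matching E m -> matching E m' -> X \subset cube E m A -> Y \subset cube E m' A' ->
  #|X| * #|Y| <= 2 ^ l * nswaps (edge_perm s) X Y ->
  2 ^ (2 * f_r r n) <= #|X| * #|Y| * 2 ^ (2 * l) ->
  [/\ #|misfit s m| <= 8 * kappa * l, #|fixedges r s| <= defect n r + 4 * l
    & #|moved (s * s)%g| * beta <= 8 * kappa * r * l].
Proof.
move=> mm mm' sX sY h1 h2; have := important_bound mm mm' sX sY h1 h2.
set B := [set e in _ | _]; set W := fixedges r s => hb.
have misB : misfit s m \subset B.
  apply/subsetP=> e /setIdP[eE /andP[h3 h4]]; rewrite in_set in_setD eE [e \in W]in_set (negbTE h3) andbF /=.
  by apply: contra h4 => /and4P[].
have shB : shifted r (s * s)%g \subset B.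
  apply/subsetP=> e /setIdP[eE]; rewrite edge_permM => h3; rewrite in_set in_setD eE [e \in W]in_set andbT.
  apply/andP; split; last by apply: contra h3 => /and4P[].
  by apply: contra h3 => /andP[_ /eqP h]; rewrite h h.
have := card_moved (s * s)%g (ltnW r1); rewrite -/beta => hm.
have := subset_leq_card misB; have := subset_leq_card shB => c1 c2.
have := defect_le s r1; rewrite -/W => hd.
have k0 : 0 < kappa by [].
move: (#|B|) (#|W|) (#|moved _|) (#|shifted _ _|) (#|misfit _ _|) hb hm c1 c2 hd.
move=> b x t sh mi hb hm c1 c2 hd.
have bb := degree_large; clear - hb hm c1 c2 hd bb k0 r1.
move: kappa k0 bb hb => k k0 bb hb.
move: (n ^ (r - 2)) bb hd => q bb hd.
move: (defect n r) hd hb => w hd hb.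
move: beta bb hm => be bb hm.
have h1 : b <= 4 * k * l + k * (t * q) by nia.
have h2 : t * be <= r * (4 * k * l + k * (t * q)).
  by apply: leq_trans hm _; rewrite leq_mul2l (leq_trans c1 h1) orbT.
have h3 : t * (2 * r * k * q) <= t * be by rewrite leq_mul2l bb orbT.
have h4 : r * (2 * k * (t * q)) <= r * (4 * k * l + k * (t * q)).
  by apply: leq_trans h2; move: h3; congr (_ <= _); clear; nia.
rewrite leq_pmul2l in h4; last by clear -r1; lia.
have h5 : k * (t * q) <= 4 * k * l by clear -h4; nia.
split; first by clear -h1 h5 c2; nia.
  by rewrite -(leq_pmul2l k0); clear - hb; nia.
apply: leq_trans h2 _; clear -h5.
apply: (@leq_trans (r * (4 * k * l + 4 * k * l))); last by apply: eq_leq; nia.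
by rewrite leq_mul2l leq_add2l h5 orbT.
Qed.

(** Where neither [s] nor [s'] misfits or fixes [e], both send [e] to [m e]. *)
Lemma misfit_distance s s' m :
  #|shifted r (s * s'^-1)%g| <=
    #|misfit s m| + #|misfit s' m| + (#|fixedges r s| + #|fixedges r s'|).
Proof.
have sub : shifted r (s * s'^-1)%g \subset
    (misfit s m :|: misfit s' m) :|: (fixedges r s :|: fixedges r s').
  apply/subsetP=> e /setIdP[eE]; rewrite edge_permM => h.
  rewrite in_set in eE; rewrite !in_set eE /=.
  case: (eqVneq (edge_perm s e) e) => h1; rewrite ?orbT //=.
  case: (eqVneq (edge_perm s' e) e) => h2; rewrite ?orbT //= ?orbF.
  rewrite -negb_and; apply: contra h => /andP[/eqP <- /eqP ->].
  by rewrite -edge_permM mulgV edge_permE; apply/eqP; rewrite (eq_imset _ (@perm1 _)) imset_id.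
apply: leq_trans (subset_leq_card sub) _.
apply: leq_trans (leq_card_setU _ _) _; apply: leq_add; exact: leq_card_setU.
Qed.

End Important.

Section Averaging.
Variable n : nat.
Local Notation graph := {set {set 'I_n}}.

Definition related (Th : {set {perm 'I_n}}) (K G : graph) : bool :=
  [exists s in Th, swaps (edge_perm s) K G].
Definition covered (Th : {set {perm 'I_n}}) (S F : {set graph}) : {set graph * graph} :=
  [set p in setX S F | related Th p.1 p.2].

Lemma covered_average Th (S F : {set graph}) a b : S != set0 ->
  a * (#|S| * #|F|) <= b * #|covered Th S F| ->
  exists2 K, K \in S & a * #|F| <= b * #|[set G in F | related Th K G]|.
Proof.
move=> S0 h; apply/exists_inP; apply: contraLR S0 => /exists_inPn hK.
rewrite negbK -cards_eq0 -leqn0 leqNgt; apply/negP=> S0.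
have : b * #|covered Th S F| < a * (#|S| * #|F|); last by rewrite ltnNge h.
have -> : #|covered Th S F| = \sum_(K in S) #|[set G in F | related Th K G]|.
  rewrite (card_fibers fst) [RHS]big_mkcond /=; apply: eq_bigr => K _.
  case: ifP => KS.
    rewrite -[RHS](@card_imset _ _ (fun G => (K, G))); last by move=> x y [].
    congr #|pred_of_set _|; apply/setP=> -[K' G]; apply/idP/imsetP.
      rewrite !in_set /= => /andP[/andP[/andP[_ GF] rel] /eqP <-].
      by exists G; rewrite // in_set GF.
    by case=> G' /setIdP[GF rel] [-> ->]; rewrite !in_set /= KS GF rel eqxx.
  apply/eqP; rewrite cards_eq0; apply/eqP/setP=> -[K' G]; rewrite !in_set /=.
  by case: eqP => [->|]; rewrite ?andbF // KS.
rewrite mulnCA -sum_nat_const big_distrr /=.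
case/card_gt0P: S0 => K0 K0S.
rewrite (bigD1 K0) //= [X in _ < X](bigD1 K0) //= -addSn.
apply: leq_add; first by rewrite ltnNge hK.
by apply: leq_sum => K /andP[KS _]; rewrite ltnW // ltnNge hK.
Qed.

End Averaging.

(** The elements of [F] are related to [K0], and [c] chooses permutations that
witness it. The cells of [c] lie in cubes, and [S] is a largest cell. *)
Section Stage.
Variables (n r : nat).
Hypothesis r1 : 1 < r.
Let E := edges n r.
Let beta := 'C(n - 2, r.-1).
Hypothesis degree_large : 2 * r * kappa * n ^ (r - 2) <= beta.
Local Notation graph := {set {set 'I_n}}.
Variables (F : {set graph}) (K0 : graph) (c : graph -> {perm 'I_n}).
Variables (Sg : {set {perm 'I_n}}) (s0 : {perm 'I_n}) (L : nat).
Hypothesis FE : forall G, G \in F -> G \subset E.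
Hypothesis K0E : K0 \subset E.
Hypothesis cF : forall G, G \in F -> swaps (edge_perm (c G)) K0 G.
Hypothesis cS : forall G, G \in F -> c G \in Sg.
Hypothesis SgL : #|Sg| <= 2 ^ L.
Hypothesis bigF : 2 ^ (2 * f_r r n) <= 4 * #|F| ^ 2.

Definition cell s : {set graph} := [set G in F | c G == s].
Let S := cell s0.
Hypothesis maxS : forall s, s \in Sg -> #|cell s| <= #|S|.

Lemma card_largest_cell : #|F| <= 2 ^ L * #|S|.
Proof.
rewrite (card_fibers c); apply: (@leq_trans (\sum_(s in Sg) #|S|)).
  rewrite [X in _ <= X]big_mkcond /=; apply: leq_sum => s _.
  case: ifP => sS; first exact: maxS.
  rewrite leqn0 cards_eq0; apply/eqP/setP=> G; rewrite !in_set.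
  apply/negP=> /andP[GF /eqP cG]; by have := cS GF; rewrite cG sS.
by rewrite sum_nat_const leq_mul2r SgL orbT.
Qed.

Lemma cell_cube s : cell s \subset cube E (reach_matching (edge_perm s) K0) K0.
Proof.
apply/subsetP=> G /setIdP[GF /eqP cG]; apply: reach_cube => //; first exact: FE.
by rewrite -cG; apply: cF.
Qed.

Definition popular l s t : bool := #|S| * #|cell t| <= 2 ^ l * nswaps (edge_perm s) S (cell t).
Definition sizeable l t : bool := 2 ^ (2 * f_r r n) <= #|S| * #|cell t| * 2 ^ (2 * l).
(** A permutation is kept if it relates a fraction 2^(-l) of the pairs between [S]
and some cell that is not too small. *)
Definition popular_perms l (Th : {set {perm 'I_n}}) :=
  [set s in Th | [exists t in Sg, popular l s t && sizeable l t]].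

Lemma popular_perms_facts l Th s : s \in popular_perms l Th ->
  [/\ #|misfit r s (reach_matching (edge_perm s0) K0)| <= 8 * kappa * l,
      #|fixedges r s| <= defect n r + 4 * l
    & #|moved (s * s)%g| * beta <= 8 * kappa * r * l].
Proof.
case/setIdP=> _ /exists_inP[t _ /andP[h1 h2]].
have rm u := @reach_matchingP _ E (edge_perm u) K0 (edge_perm_edges r u).
exact: (important_facts r1 degree_large (rm s0) (rm t) (cell_cube s0) (cell_cube t) h1 h2).
Qed.

Lemma popular_perms_close l Th s s' : s \in popular_perms l Th -> s' \in popular_perms l Th ->
  #|shifted r (s * s'^-1)%g| <= 24 * kappa * l + 2 * defect n r.
Proof.
move=> /popular_perms_facts[a1 a2 _] /popular_perms_facts[b1 b2 _].
have hl : l <= kappa * l by rewrite leq_pmull.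
have sum (x a b c' d w q l0 : nat) : a <= 8 * q -> b <= 8 * q -> c' <= w + 4 * l0 ->
  d <= w + 4 * l0 -> l0 <= q -> x <= a + b + (c' + d) -> x <= 24 * q + 2 * w by clear; lia.
rewrite -mulnA; rewrite -mulnA in a1 b1.
exact: sum a1 b1 a2 b2 hl (misfit_distance r s s' _).
Qed.

(** Pairs related by no popular permutation are of two kinds: their second
element is in a small cell, or they belong to a cell to which their permutation
relates few elements of [S]. Each kind is at most one pair in 32. *)
Lemma cover_loss l La (Th : {set {perm 'I_n}}) : #|Th| <= 2 ^ La -> L + 5 <= l -> La + 5 <= l ->
  16 * #|covered Th S F| <= 16 * #|covered (popular_perms l Th) S F| + #|S| * #|F|.
Proof.
move=> ThL Ll Lal.
pose A := [set p in setX S F | ~~ sizeable l (c p.2)].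
pose B := [set p in covered Th S F | [exists s in Th,
   swaps (edge_perm s) p.1 p.2 && ~~ popular l s (c p.2)]].
have sub : covered Th S F \subset covered (popular_perms l Th) S F :|: (A :|: B).
  apply/subsetP=> p pc; rewrite !in_setU.
  case/setIdP: (pc) => pSF /exists_inP[s sTh sw].
  have pF : p.2 \in F by move: pSF; case: p {pc sw} => x y /setXP[].
  have [z|z] := boolP (sizeable l (c p.2)); last by rewrite [p \in A]in_set pSF z /= orbT.
  have [q|q] := boolP (popular l s (c p.2)); last first.
    apply/orP; right; apply/orP; right; rewrite in_set pc; apply/exists_inP.
    by exists s => //; rewrite sw q.
  apply/orP; left; rewrite in_set pSF /=; apply/exists_inP; exists s => //.
  by rewrite in_set sTh; apply/exists_inP; exists (c p.2); rewrite ?q ?z ?cS.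
have cellSF t : [set p in setX S F | c p.2 == t] = setX S (cell t).
  by apply/setP=> -[x y]; rewrite !in_set /= -andbA.
have hA : 32 * #|A| <= #|S| * #|F|.
  have hA1 : 2 ^ (2 * l) * #|A| <= 2 ^ L * 2 ^ (2 * f_r r n).
    rewrite (card_fibers (fun p => c p.2)) big_distrr /=.
    apply: (@leq_trans (\sum_(t in Sg) 2 ^ (2 * f_r r n))); last first.
      by rewrite sum_nat_const leq_mul2r SgL orbT.
    rewrite [X in _ <= X]big_mkcond /=; apply: leq_sum => t _.
    have [tS|tS] := boolP (t \in Sg).
      have [z|z] := boolP (sizeable l t).
        rewrite (_ : [set _ in A | _] = set0) ?cards0 ?muln0 //.
        by apply/setP=> p; rewrite !in_set; case: (c p.2 =P t) => [->|]; rewrite ?andbF // z !andbF.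
      apply: leq_trans (ltnW _); last by rewrite ltnNge; exact: z.
      rewrite mulnC leq_mul2r -cardsX -cellSF; apply/orP; right.
      by apply/subset_leq_card/subsetP=> p /setIdP[/setIdP[p1 _] p2]; rewrite in_set p1 p2.
    rewrite (_ : [set _ in A | _] = set0) ?cards0 ?muln0 //.
    apply/setP=> -[x y]; rewrite [RHS]in_set; apply/negP=> /setIdP[/setIdP[/setXP[_ yF] _] /eqP ct].
    by move: tS; rewrite -ct cS.
  have e2 : 2 ^ (2 * l) = 2 ^ (2 * L) * 2 ^ 10 * 2 ^ (2 * l - 2 * L - 10).
    by rewrite -!expnD; congr (2 ^ _); clear -Ll; lia.
  have hA2 : 2 ^ (2 * l) * #|A| <= 2 ^ (2 * L) * 4 * (#|S| * #|F|).
    apply: leq_trans hA1 _; apply: leq_trans (leq_mul (leqnn _) bigF) _.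
    have := card_largest_cell; rewrite mul2n -addnn expnD => hl.
    rewrite expnS expn1; move: (2 ^ L) (#|F|) (#|S|) hl => x f' y hl.
    rewrite (_ : _ * _ = 4 * x * f' * f'); last by clear; lia.
    rewrite (_ : _ * (y * f') = 4 * x * f' * (x * y)); last by clear; lia.
    by rewrite leq_mul2l hl orbT.
  have : 2 ^ (2 * L) * 2 ^ 10 * #|A| <= 2 ^ (2 * L) * 4 * (#|S| * #|F|).
    apply: leq_trans hA2; rewrite e2 leq_mul2r leq_pmulr ?orbT // expn_gt0 //.
  rewrite -!mulnA leq_pmul2l ?expn_gt0 //; clear; lia.
have hB : 32 * #|B| <= #|S| * #|F|.
  have hB1 : 2 ^ l * #|B| <= 2 ^ La * (#|S| * #|F|).
    apply: (@leq_trans (\sum_(s in Th) #|S| * #|F|)); last first.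
      by rewrite sum_nat_const leq_mul2r ThL orbT.
    apply: (@leq_trans (\sum_(s in Th) 2 ^ l * #|[set p in setX S F |
        swaps (edge_perm s) p.1 p.2 && ~~ popular l s (c p.2)]|)).
      rewrite -big_distrr /= leq_mul2l; apply/orP; right.
      rewrite (eq_bigr (fun s => \sum_(p in setX S F) (swaps (edge_perm s) p.1 p.2 && ~~ popular l s (c p.2) : nat))).
        rewrite exchange_big /= -sum1_card big_mkcond [X in _ <= X]big_mkcond /=.
        apply: leq_sum => p _; case: ifP => //; rewrite in_set => /andP[/setIdP[-> _]].
        by case/exists_inP=> s sTh h; rewrite (bigD1 s) //= h.
      move=> s _; rewrite -sum1_card -big_mkcondr /=.
      by apply: eq_bigl => p; rewrite in_set.
    apply: leq_sum => s _; rewrite (card_fibers (fun p => c p.2)) big_distrr /=.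
    rewrite [X in #|S| * X](card_fibers c) big_distrr /=; apply: leq_sum => t _.
    rewrite -/(cell t); have [q|q] := boolP (popular l s t).
      rewrite (_ : [set _ in _ | _] = set0) ?cards0 ?muln0 //.
      apply/setP=> p; rewrite !in_set; case: (c p.2 =P t) => [->|]; rewrite ?andbF //.
      by rewrite q !andbF.
    apply: leq_trans (ltnW _); last by rewrite ltnNge; exact: q.
    rewrite leq_mul2l; apply/orP; right; apply/subset_leq_card/subsetP=> -[x y].
    case/setIdP=> /setIdP[/setXP[xS yF] /andP[sw _]] ct.
    by rewrite in_set xS /= sw andbT in_set yF.
  have e2 : 2 ^ l = 2 ^ La * 2 ^ 5 * 2 ^ (l - La - 5).
    by rewrite -!expnD; congr (2 ^ _); clear -Lal; lia.
  have : 2 ^ La * 2 ^ 5 * #|B| <= 2 ^ La * (#|S| * #|F|).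
    apply: leq_trans hB1; rewrite e2 leq_mul2r leq_pmulr ?orbT // expn_gt0 //.
  by rewrite -!mulnA leq_pmul2l ?expn_gt0.
have [u1 _] := leq_card_setU (covered (popular_perms l Th) S F) (A :|: B).
have [u2 _] := leq_card_setU A B.
have sum (x y u v a b q : nat) : 32 * a <= q -> 32 * b <= q -> u <= y + v ->
  v <= a + b -> x <= u -> 16 * x <= 16 * y + q by clear; lia.
exact: sum hA hB u1 u2 (subset_leq_card sub).
Qed.

End Stage.

(** * The quadratic invariant *)

Section Quadratic.
Variables (T : finType) (adj : rel T).
Hypothesis adjC : symmetric adj.
Local Open Scope ring_scope.
Implicit Types (x y z : T -> int) (e f : T).

Definition bil x y : int := \sum_e \sum_f x e * y f * (adj e f)%:R.

Lemma bilDl x y z : bil (fun e => x e + y e) z = bil x z + bil y z.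
Proof.
rewrite /bil -big_split /=; apply: eq_bigr => e _.
by rewrite -big_split /=; apply: eq_bigr => f _; rewrite mulrDl mulrDl.
Qed.

Lemma bilC x y : bil x y = bil y x.
Proof.
rewrite /bil exchange_big /=; apply: eq_bigr => e _; apply: eq_bigr => f _.
by rewrite adjC (mulrC (x f)).
Qed.

Lemma bilZl (a : int) x z : bil (fun e => a * x e) z = a * bil x z.
Proof.
rewrite /bil [RHS]big_distrr /=; apply: eq_bigr => e _.
rewrite [RHS]big_distrr /=; by apply: eq_bigr => f _; rewrite !mulrA.
Qed.

Lemma bilDr x y z : bil x (fun e => y e + z e) = bil x y + bil x z.
Proof. by rewrite bilC bilDl !(bilC x). Qed.

Lemma bilZr (a : int) x z : bil x (fun e => a * z e) = a * bil x z.
Proof. by rewrite bilC bilZl (bilC x). Qed.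

Definition point e f : int := (f == e)%:R.

Lemma bil_point e y : bil (point e) y = \sum_f y f * (adj e f)%:R.
Proof.
rewrite /bil (bigD1 e) //= [X in _ + X]big1 ?addr0.
  by apply: eq_bigr => f _; rewrite /point eqxx mul1r.
move=> f fe; rewrite big1 // => h _; by rewrite /point (negbTE fe) !mul0r.
Qed.

Lemma bil_points e f : bil (point e) (point f) = (adj e f)%:R.
Proof.
rewrite bil_point (bigD1 f) //= [X in _ + X]big1 ?addr0 /point ?eqxx ?mul1r //.
by move=> h hf; rewrite (negbTE hf) mul0r.
Qed.

Lemma eq_bil x x' y y' : x =1 x' -> y =1 y' -> bil x y = bil x' y'.
Proof.
by move=> h1 h2; apply: eq_bigr => e _; apply: eq_bigr => f _; rewrite h1 h2.
Qed.

(** For the indicator of a hypergraph H, the number of ordered pairs of adjacent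
edges of H. *)
Definition energy x := bil x x.

Lemma energyD x y : energy (fun e => x e + y e) = energy x + 2 * bil x y + energy y.
Proof. by rewrite /energy bilDl !bilDr (bilC y x); ring. Qed.

Definition ind (H : {set T}) e : int := (e \in H)%:R.

Lemma energy_perm x (g : {perm T}) : (forall e f, adj (g e) (g f) = adj e f) ->
  energy (fun e => x (g e)) = energy x.
Proof.
move=> gadj; rewrite /energy /bil [RHS](reindex_inj (@perm_inj _ g)) /=.
apply: eq_bigr => e _; rewrite [RHS](reindex_inj (@perm_inj _ g)) /=.
by apply: eq_bigr => f _; rewrite gadj.
Qed.

Lemma energy_imset (H : {set T}) (g : {perm T}) : (forall e f, adj (g e) (g f) = adj e f) ->
  energy (ind (g @: H)) = energy (ind H).
Proof.
move=> gadj; rewrite -(energy_perm _ gadj); apply: eq_bil => e;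
  by rewrite /ind mem_imset //; apply: perm_inj.
Qed.

Lemma energy_swaps (g : {perm T}) (K1 K2 : {set T}) : (forall e f, adj (g e) (g f) = adj e f) ->
  swaps g K1 K2 -> energy (ind (K1 :\: K2)) = energy (ind (K2 :\: K1)).
Proof. by move=> gadj /eqP <-; rewrite energy_imset. Qed.

End Quadratic.

Section FourToggles.
Variables (T : finType) (E : {set T}) (m : T -> T) (A : {set T}).
Hypothesis mm : matching E m.
Variable Gd : {set {set T}}.
Hypothesis most : 4 * #|cube E m A :\: Gd| < #|cube E m A|.

(** A union bound: each of the four values of the two bits at [p] and [q] maps
the cube to itself, and the [K] such that one of the results is outside [Gd]
number at most four times the complement of [Gd]. *)
Lemma four_toggles p q : p \in E -> q \in E -> m p != p -> m q != q ->
  q != p -> q != m p ->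
  exists2 K, K \in cube E m A & forall i j, set_bit m i p (set_bit m j q K) \in Gd.
Proof.
move=> pE qE mp mq qp qmp.
have [|none] := boolP [exists K in cube E m A,
    [forall i, forall j, set_bit m i p (set_bit m j q K) \in Gd]].
  case/exists_inP=> K KC /forallP h; exists K => // i j; exact: (forallP (h i)).
pose ij K := odflt (true, true)
  [pick ij : bool * bool | set_bit m ij.1 p (set_bit m ij.2 q K) \notin Gd].
pose h K := set_bit m (ij K).1 p (set_bit m (ij K).2 q K).
have hC K : K \in cube E m A -> h K \in cube E m A :\: Gd.
  move=> KC; rewrite in_setD; apply/andP; split.
    rewrite /h /ij; case: pickP => [//|no].
    move/exists_inPn: none => /(_ _ KC); rewrite negb_forall => /existsP[i].
    by rewrite negb_forall => /existsP[j hij]; have := no (i, j); rewrite hij.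
  by rewrite !(set_bit_cube mm).
have inj : {in cube E m A &, injective (fun K => (h K, (p \in K, q \in K)))}.
  move=> K1 K2 C1 C2 [hh b1 b2]; move: hh; rewrite /h.
  move: (ij K1) (ij K2) => [i1 j1] [i2 j2] /= hh.
  have ei : i1 = i2.
    by move/setP/(_ p): hh; rewrite !in_set_bit // eqxx.
  have ej : j1 = j2.
    move/setP/(_ q): hh.
    by rewrite !(in_set_bit _ _ _ mp) (negbTE qp) (negbTE qmp) !(in_set_bit _ _ _ mq) eqxx.
  rewrite -{}ei -{}ej in hh.
  apply: (set_bit_inj mm qE mq C1 C2 b2).
  have [D1 D2] : set_bit m j1 q K1 \in cube E m A /\ set_bit m j1 q K2 \in cube E m A.
    by rewrite !(set_bit_cube mm).
  apply: (set_bit_inj mm pE mp D1 D2 _ hh).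
  rewrite !(in_set_bit _ _ _ mq) eq_sym (negbTE qp) b1.
  by case: eqP.
have : #|cube E m A| <= #|setX (cube E m A :\: Gd) [set: bool * bool]|.
  rewrite -(card_in_imset inj); apply/subset_leq_card/subsetP=> _ /imsetP[K KC ->].
  by rewrite in_setX hC // in_setT.
by rewrite cardsX cardsT card_prod card_bool mulnC leqNgt most.
Qed.
End FourToggles.

(** Two values of an affine function coincide only if its slope vanishes. *)
Lemma slope_eq0 (x y z : int) : (2 * (x + y) + z = 2 * x + z -> y = 0)%R.
Proof. lia. Qed.

(** The setting of the last step: [G] is related to more than three quarters of
the cube in which every edge moved by the involution [iota] is matched with its
image. *)
Section Absorb.
Variables (n r : nat).
Hypothesis r1 : 1 < r.
Hypothesis nbig : 4 * r + 10 <= n.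
Variable iota : {perm 'I_n}.
Hypothesis inv : forall x, iota (iota x) = x.
Hypothesis fixr : #|fixpoints iota| <= r.
Let E := edges n r.
Let m : {set 'I_n} -> {set 'I_n} := edge_perm iota.
Variables (A : {set {set 'I_n}}) (Gd : {set {set {set 'I_n}}}) (G : {set {set 'I_n}}).
Hypothesis most : 4 * #|cube E m A :\: Gd| < #|cube E m A|.
Hypothesis GE : G \subset E.
Hypothesis relG : forall K, K \in Gd -> exists s, swaps (edge_perm s) G K.

(** Adjacency has to be this close: then an edge with two broken 2-cycles is
adjacent to just two invariant edges ([near_broken]). *)
Definition near (e f : {set 'I_n}) := #|e :&: f| == r.-1.

Lemma nearC : symmetric near.
Proof. by move=> e f; rewrite /near setIC. Qed.

Lemma near_perm s e f : near (edge_perm s e) (edge_perm s f) = near e f.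
Proof.
rewrite /near !edge_permE -imsetI; last by move=> x y _ _; apply: perm_inj.
by rewrite card_imset //; apply: perm_inj.
Qed.

Lemma in_m x e : (x \in m e) = (iota x \in e).
Proof.
by rewrite /m edge_permE -{1}(inv x) mem_imset //; apply: perm_inj.
Qed.

Lemma mK e : m (m e) = e.
Proof. by apply/setP=> x; rewrite !in_m inv. Qed.

Lemma mE e : (m e \in E) = (e \in E).
Proof. exact: edge_perm_edges. Qed.

Lemma m_matching : matching E m.
Proof. by split=> e; rewrite ?mK ?mE. Qed.

(** [discrepancy true K] is G \ K and [discrepancy false K] is K \ G; the boolean
allows the two to be treated alike. *)
Definition discrepancy b (K : {set {set 'I_n}}) : {set {set 'I_n}} :=
  [set e in E | ((e \in G) == b) && ((e \in K) != b)].

Lemma in_discrepancy b K e :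
  (e \in discrepancy b K) = [&& e \in E, (e \in G) == b & (e \in K) != b].
Proof. exact: in_set. Qed.

Lemma discrepancy_energy b K : K \in Gd -> K \in cube E m A ->
  energy near (ind (discrepancy b K)) = energy near (ind (discrepancy (~~ b) K)).
Proof.
move=> KG /cubeP[KE _]; have [s sw] := relG KG.
have e1 : G :\: K = discrepancy true K.
  apply/setP=> e; rewrite !in_set; have := subsetP GE e; rewrite !in_set.
  by case: (e \in G) => [->//|_]; rewrite ?andbF //; case: (e \in K).
have e2 : K :\: G = discrepancy false K.
  apply/setP=> e; rewrite !in_set; have := subsetP KE e; rewrite !in_set.
  by case: (e \in K) => [->//|_]; rewrite ?andbF //; case: (e \in G).
have := energy_swaps (near_perm s) sw; rewrite e1 e2.
by case: b.
Qed.

Lemma cube_toggle i p K : p \in E -> m p != p -> K \in cube E m A ->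
  set_bit m i p K \in cube E m A.
Proof. by move=> pE mp KC; apply: (set_bit_cube m_matching). Qed.

(** Suppose that both edges [q] and [m q] are in [G], or both are not, according
to [b]. Changing the bit of [K] at [q] exchanges [q] and [m q] in
[discrepancy b K] and does not change [discrepancy (~~ b) K], so the energy of
the former stays the same, whatever the bit at [p] is. As [p] itself enters or
leaves [discrepancy b K] with its bit, the second difference in the bits at [p]
and [q] is a nonzero multiple of [near p q - near p (m q)]. *)
Lemma anomaly_near b p q : p \in E -> q \in E -> m p != p -> m q != q ->
  q != p -> q != m p -> (q \in G) = b -> (m q \in G) = b -> (p \in G) = b ->
  near p q = near p (m q).
Proof.
move=> pE qE mp mq qp qmp qG mqG pG.
have [K KC good4] := four_toggles m_matching most pE qE mp mq qp qmp.
pose Kt i j := set_bit m i p (set_bit m j q K).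
have KtC i j : Kt i j \in cube E m A by rewrite !cube_toggle.
have pq : p != q by rewrite eq_sym.
have pmq : p != m q by apply: contra qmp => /eqP ->; rewrite mK.
have mpq : m p != q by rewrite eq_sym.
have mpmq : m p != m q by apply: contra pq => /eqP h; rewrite -(mK p) h mK.
have Ktin i j e : (e \in Kt i j) = if e == p then i else if e == m p then ~~ i
   else if e == q then j else if e == m q then ~~ j else e \in K.
  by rewrite (in_set_bit _ _ _ mp) (in_set_bit _ _ _ mq).
have enq i : energy near (ind (discrepancy b (Kt i true))) =
    energy near (ind (discrepancy b (Kt i false))).
  rewrite (discrepancy_energy b (good4 i true) (KtC i true)).
  rewrite (discrepancy_energy b (good4 i false) (KtC i false)).
  congr (energy near (ind _)); apply/setP=> e; rewrite !in_discrepancy !Ktin.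
  case: (e == p) => //; case: (e == m p) => //.
  case: (eqVneq e q) => [->|_]; first by rewrite qG; case: (b); rewrite ?andbF.
  case: (eqVneq e (m q)) => [->|_] //; by rewrite mqG; case: (b); rewrite ?andbF.
pose c := (m p \in G) == b.
pose u : int := (if b then -1 else 1)%R.
pose dl e : int := (u * point p e + (- (u * c%:R)) * point (m p) e)%R.
pose et e : int := (u * point q e + (- u) * point (m q) e)%R.
have xd j e : ind (discrepancy b (Kt true j)) e = (ind (discrepancy b (Kt false j)) e + dl e)%R.
  rewrite /dl /point /ind !in_discrepancy !Ktin.
  have [->|ep] := eqVneq e p.
    rewrite (eq_sym p (m p)) (negbTE mp) pG mulr0 addr0 mulr1 pE.
    by rewrite /u; case: (b).
  have [->|emp] := eqVneq e (m p).
    rewrite mulr0 add0r mulr1 mE pE /c /u.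
    by case: (m p \in G); case: (b).
  by rewrite !mulr0 !addr0.
have xe i e : ind (discrepancy b (Kt i true)) e = (ind (discrepancy b (Kt i false)) e + et e)%R.
  rewrite /et /point /ind !in_discrepancy !Ktin.
  have [->|ep] := eqVneq e p; first by rewrite (negbTE pq) (negbTE pmq) !mulr0 !addr0.
  have [->|emp] := eqVneq e (m p); first by rewrite (negbTE mpq) (negbTE mpmq) !mulr0 !addr0.
  have [->|eq] := eqVneq e q.
    rewrite (eq_sym q (m q)) (negbTE mq) qG mulr0 addr0 mulr1 qE.
    by rewrite /u; case: (b).
  have [->|emq] := eqVneq e (m q).
    rewrite mulr0 add0r mulr1 mE qE mqG /u.
    by case: (b).
  by rewrite !mulr0 !addr0.
have step i : (2 * bil near (ind (discrepancy b (Kt i false))) et + energy near et = 0)%R.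
  have := enq i; rewrite [energy near (ind (discrepancy b (Kt i true)))](eq_bil near (xe i) (xe i)).
  rewrite -/(energy near _) (energyD nearC).
  by move=> h; apply: (addrI (energy near (ind (discrepancy b (Kt i false))))); rewrite addr0 addrA.
have bz : bil near dl et = 0%R.
  have := etrans (step true) (esym (step false)).
  rewrite (eq_bil near (xd false) (frefl et)) bilDl.
  exact: slope_eq0.
have npq : near (m p) q = near p (m q) by rewrite -(near_perm iota) -/m mK.
have npp : near (m p) (m q) = near p q by rewrite near_perm.
move: bz; rewrite /dl /et bilDl !bilZl !(bilDr nearC) !(bilZr nearC) !bil_points npq npp /u.
by case: (near p q); case: (near p (m q)); case: (b); case: (c).
Qed.

(** So an edge [p] that is adjacent to only one of [q] and [m q] must be an
anomaly of the opposite type. *)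
Lemma anomaly_flips p q : p \in E -> q \in E -> m p != p -> m q != q ->
  q != p -> q != m p -> (q \in G) = (m q \in G) -> near p q != near p (m q) ->
  (p \in G) = ~~ (q \in G) /\ (m p \in G) = ~~ (q \in G).
Proof.
move=> pE qE mp mq qp qmp qG npq.
have flip p' : p' \in E -> m p' != p' -> q != p' -> q != m p' ->
    near p' q != near p' (m q) -> (p' \in G) = ~~ (q \in G).
  move=> p'E mp' qp' qmp' np'; case: (boolP (q \in G)) => qb; case: (boolP (p' \in G)) => // pb.
    move: np'; rewrite (anomaly_near (b := true) p'E qE mp' mq qp' qmp') ?eqxx //.
    by rewrite -qG.
  move: np'; rewrite (anomaly_near (b := false) p'E qE mp' mq qp' qmp') ?eqxx //.
  - exact/negbTE.
  - by rewrite -qG; apply/negbTE.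
  exact/negbTE.
split; first exact: flip.
apply: flip; rewrite ?mE ?mK // 1?eq_sym //.
have -> : near (m p) q = near p (m q) by rewrite -(near_perm iota) -/m mK.
have -> : near (m p) (m q) = near p q by rewrite near_perm.
by [].
Qed.

Lemma fresh (B : {set 'I_n}) : #|B| + r < n -> exists2 z, z \notin B & iota z != z.
Proof.
move=> lt; have : 0 < #|~: (B :|: fixpoints iota)|.
  have := cardsC (B :|: fixpoints iota); rewrite card_ord.
  have [h _] := leq_card_setU B (fixpoints iota).
  by move: fixr h lt; move: #|_| #|_| #|_| #|_|; clear; lia.
by case/card_gt0P=> z; rewrite !inE negb_or => /andP[zB zi]; exists z.
Qed.

Lemma not_fixed (e : {set 'I_n}) x : x \in e -> iota x \notin e -> m e != e.
Proof.
by move=> xe; apply: contra => /eqP me; rewrite (edge_perm_fix _ me).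
Qed.

(** Let [e] be an anomaly, [a] a vertex of [e] with [iota a] outside [e]. Remove
another vertex [b] from [e] and add [z] or [w] to get [f] and [h]. Among [e],
[f] and [h] any two are adjacent while neither is adjacent to the image of the
other, so that they are anomalies of pairwise opposite types; but there are
only two types. *)
Lemma moved_edges_split e : e \in E -> m e != e -> (m e \in G) = (e \notin G).
Proof.
move=> eE me; apply/eqP; rewrite -[_ == _]negbK; apply/negP=> anom.
have eG : (e \in G) = (m e \in G).
  by move: anom; case: (e \in G); case: (m e \in G).
have ce : #|e| = r by apply/eqP; move: eE; rewrite inE.
have cme : #|m e| = r by apply/eqP; move: eE; rewrite -mE inE.
have [a ae iae] : exists2 a, a \in e & iota a \notin e.
  have [/existsP[a /andP[h1 h2]]|/existsPn h] := boolP [exists a, (a \in e) && (iota a \notin e)].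
    by exists a.
  case/edge_perm_fixP: me => a ae; have := h a; by rewrite ae negbK.
have [b be] : exists b, b \in e :\ a.
  by apply/card_gt0P; have := cardsD1 a e; rewrite ae ce; clear -r1; lia.
have [bane be'] := setD1P be.
have cU : #|e :|: m e| <= 2 * r.
  by have [h _] := leq_card_setU e (m e); move: h; rewrite ce cme; clear; lia.
have lt2 k : k <= 2 * r + 2 -> k + r < n by clear -nbig; lia.
have [z + iz] := fresh (lt2 _ (leq_trans cU (leq_addr _ _))).
rewrite in_setU negb_or => /andP[ze zme].
have cU' : #|(e :|: m e) :|: [set z; iota z]| <= 2 * r + 2.
  have [h _] := leq_card_setU (e :|: m e) [set z; iota z].
  by move: h; rewrite cards2; case: (z != iota z); clear -cU; lia.
have [w + iw] := fresh (lt2 _ cU').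
rewrite !in_setU !negb_or !in_set1 => /andP[/andP[we wme] /andP[wz wiz]].
rewrite in_m in zme; rewrite in_m in wme.
pose f := z |: (e :\ b); pose h := w |: (e :\ b).
have ceb : #|e :\ b| = r.-1 by have := cardsD1 b e; rewrite be' ce; clear; lia.
have edge x : x \notin e -> (x |: (e :\ b) \in E).
  by move=> xe; rewrite inE cardsU1 in_setD1 negb_and xe orbT ceb; apply/eqP; clear -r1; lia.
have nfix x : x \notin e -> iota x \notin e -> iota x != x -> m (x |: (e :\ b)) != x |: (e :\ b).
  move=> xe ixe ix; apply: (@not_fixed _ x); first by rewrite setU11.
  by rewrite in_setU1 in_setD1 (negbTE ix) (negbTE ixe) andbF.
have neq x : x \notin e -> e != x |: (e :\ b).
  by move=> xe; apply: contra xe => /eqP ->; rewrite setU11.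
have neqm x : x \notin e -> iota x \notin e -> e != m (x |: (e :\ b)).
  move=> xe ixe; apply: contra ixe => /eqP ->; by rewrite in_m inv setU11.
have ceba : #|e :\ b :\ a| = r.-1.-1.
  by have := cardsD1 a (e :\ b); rewrite in_setD1 eq_sym bane ae ceb; clear; lia.
have near_e x : x \notin e -> near (x |: (e :\ b)) e.
  move=> xe; rewrite /near setIUl (_ : [set x] :&: e = set0).
    by rewrite set0U (setIidPl _) ?subD1set // ceb.
  by apply/setP=> y; rewrite !inE; case: eqP => // ->; rewrite (negbTE xe).
have far_sub (X : {set 'I_n}) : X \subset e :\ b :\ a -> #|X| == r.-1 = false.
  by move=> /subset_leq_card; rewrite ceba => hX; apply/eqP; clear -hX r1; lia.
have near_me x : iota x \notin e -> near (x |: (e :\ b)) (m e) = false.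
  move=> ixe; apply: far_sub; apply/subsetP=> y; rewrite !inE in_m.
  case/andP=> /orP[/eqP ->|/andP[yb ye] iye]; first by rewrite (negbTE ixe).
  by rewrite yb ye !andbT; apply: contraNneq iae => <-.
have [f1 f2] := anomaly_flips (edge z ze) eE (nfix z ze zme iz) me (neq z ze) (neqm z ze zme) eG
  ltac:(by rewrite near_e // near_me).
have [h1 h2] := anomaly_flips (edge w we) eE (nfix w we wme iw) me (neq w we) (neqm w we wme) eG
  ltac:(by rewrite near_e // near_me).
have fh : f != h.
  apply/eqP=> /setP/(_ w); rewrite !inE eqxx /= (negbTE wz) (negbTE we) andbF. by [].
have fmh : f != m h.
  apply/eqP=> /setP/(_ z); rewrite in_m !inE eqxx /= (negbTE zme) andbF orbF.
  by move/esym/eqP=> hz; move: wiz; rewrite hz eqxx.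
have nhf : near h f.
  rewrite /near (_ : h :&: f = e :\ b) ?ceb //.
  apply/setP=> y; rewrite !inE; case: (y \in e); case: (y != b); rewrite ?orbT //= ?orbF.
    by case: eqP => // ->; rewrite (negbTE wz).
    by case: eqP => // ->; rewrite (negbTE wz).
  by case: eqP => // ->; rewrite (negbTE wz).
have nhmf : near h (m f) = false.
  apply: far_sub; apply/subsetP=> y; rewrite !inE in_m !inE.
  case/andP=> /orP[/eqP ->|/andP[yb ye]].
    rewrite (negbTE wme) andbF orbF => /eqP hz.
    by move: wiz; rewrite -hz inv eqxx.
  case/orP=> [/eqP hz|/andP[_ iye]]; first by move: zme; rewrite -hz inv ye.
  by rewrite yb ye !andbT; apply: contraNneq iae => <-.
have [] := anomaly_flips (edge w we) (edge z ze) (nfix w we wme iw) (nfix z ze zme iz) fh fmh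
  (etrans f1 (esym f2)) ltac:(by rewrite nhf nhmf).
by rewrite h1 f1; case: (e \in G).
Qed.

(** The difference of [G] and the cube on the invariant edges. *)
Definition gap (f : {set 'I_n}) : int :=
  (if (f \in E) && (m f == f) then (f \in G)%:R - (f \in A)%:R else 0)%R.

Lemma gap_m f : gap (m f) = gap f.
Proof.
rewrite /gap mE mK eq_sym; case: (boolP ((f \in E) && (m f == f))) => // /andP[_ /eqP ->].
by [].
Qed.

(** By [moved_edges_split], G \ K and the image of K \ G under [iota] have the
same moved edges; their indicators differ by [gap]. Changing the bit at [p]
adds the same multiple of the indicator of [p] to both, so equality of energies
forces [gap] to be orthogonal to it. *)
Lemma gap_orthogonal_in p q : p \in E -> q \in E -> m p != p -> m q != q ->
  q != p -> q != m p -> p \in G -> bil near (point p) gap = 0%R.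
Proof.
move=> pE qE mp mq qp qmp pG.
have [K KC good4] := four_toggles m_matching most pE qE mp mq qp qmp.
pose Kt i := set_bit m i p (set_bit m true q K).
have KtC i : Kt i \in cube E m A by rewrite !cube_toggle.
pose x i := ind (discrepancy true (Kt i)); pose y i e : int := ind (discrepancy false (Kt i)) (m e).
have xy i e : x i e = (y i e + gap e)%R.
  have /cubeP[_ hK] := KtC i.
  rewrite /x /y /gap /ind !in_discrepancy mE; have [eE|//] := boolP (e \in E).
  have [me|me] := eqVneq (m e) e.
    by rewrite me (hK _ eE) me eqxx; case: (e \in G); case: (e \in A).
  rewrite (moved_edges_split eE me) (hK _ eE) (negbTE me).
  by case: (e \in G); case: (m e \in Kt i).
have exy i : energy near (x i) = energy near (y i).
  rewrite /x (discrepancy_energy true (good4 i true) (KtC i)) /y /=.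
  by rewrite (energy_perm (g := edge_perm iota) _ (near_perm iota)).
have step i : (2 * bil near (y i) gap + energy near gap = 0)%R.
  have := exy i; rewrite [energy near (x i)](eq_bil near (xy i) (xy i)).
  rewrite -/(energy near _) (energyD nearC).
  by move=> h; apply: (addrI (energy near (y i))); rewrite addr0 addrA.
have yd e : y false e = (y true e + point p e)%R.
  suff : x false e = (x true e + point p e)%R.
    by rewrite !xy addrAC => /addIr.
  rewrite /x /point /ind !in_discrepancy !(in_set_bit _ _ _ mp).
  have [->|ep] := eqVneq e p; first by rewrite pE pG.
  have [->|emp] := eqVneq e (m p); last by rewrite addr0.
  by rewrite (moved_edges_split pE mp) pG andbF.
have := etrans (step false) (esym (step true)).
rewrite (eq_bil near yd (frefl gap)) bilDl; exact: slope_eq0.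
Qed.

Lemma gap_orthogonal p q : p \in E -> q \in E -> m p != p -> m q != q ->
  q != p -> q != m p -> bil near (point p) gap = 0%R.
Proof.
move=> pE qE mp mq qp qmp; have [pG|pG] := boolP (p \in G).
  exact: (gap_orthogonal_in (q := q)).
have <- : bil near (point (m p)) gap = bil near (point p) gap.
  rewrite !bil_point (reindex_inj (can_inj mK)) /=; apply: eq_bigr => f _.
  by rewrite gap_m near_perm.
apply: (gap_orthogonal_in (q := q)); rewrite ?mE ?mK ?(moved_edges_split pE mp) //.
by rewrite eq_sym.
Qed.

Definition swap_pair (e : {set 'I_n}) a b := b |: (iota b |: (e :\ a :\ iota a)).

Lemma gap_eq0 f : ~~ ((f \in E) && (m f == f)) -> gap f = 0%R.
Proof. by rewrite /gap => /negbTE ->. Qed.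

(** In the edge [e - a + b] the 2-cycles of [a] and [b] are both broken, and an
invariant edge differing from it by one exchange has to repair both: it
restores [a] at the expense of [b], or replaces [iota a] by [iota b]. *)
Lemma near_broken e a b f : e \in E -> m e = e -> a \in e -> iota a != a ->
  b \notin e -> iota b != b -> f \in E -> m f = f ->
  near (b |: (e :\ a)) f -> f = e \/ f = swap_pair e a b.
Proof.
move=> eE me ae ia be ib fE mf; rewrite /near.
set p := b |: (e :\ a) => /eqP npf.
have ce : #|e| = r by apply/eqP; move: eE; rewrite inE.
have cf : #|f| = r by apply/eqP; move: fE; rewrite inE.
have iae : iota a \in e by rewrite (edge_perm_fix _ me).
have ibe : iota b \notin e by rewrite (edge_perm_fix _ me).
have cp : #|p| = r.
  rewrite cardsU1 in_setD1 (negbTE be) andbF; have := cardsD1 a e; rewrite ae ce; clear; lia.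
have pf1 : #|p :\: f| = 1 by have := cardsID f p; rewrite cp npf; clear -r1; lia.
have fp1 : #|f :\: p| = 1.
  by have := cardsID p f; rewrite setIC cf npf; clear -r1; lia.
have ap : a \notin p.
  by rewrite !inE eqxx orbF; apply: contraTneq ae => ->.
have ibp : iota b \notin p by rewrite !inE (negbTE ib) (negbTE ibe) andbF.
have iap : iota a \in p by rewrite !inE ia iae orbT.
have bp : b \in p by rewrite setU11.
have fi x : (iota x \in f) = (x \in f) by rewrite (edge_perm_fix _ mf).
have one (X : {set 'I_n}) x y : #|X| = 1 -> x \in X -> y \in X -> x = y.
  by move=> /eqP/cards1P[u ->]; rewrite !inE => /eqP -> /eqP ->.
have [bf|bf] := boolP (b \in f); last first.
  left; apply/esym/eqP; rewrite eqEcard ce cf leqnn andbT; apply/subsetP=> x xe.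
  have inpf y : y \in p -> y != b -> y \in f.
    move=> yp yb; apply: contraNT yb => yf; apply/eqP.
    by apply: (one _ _ _ pf1); rewrite in_setD ?yf ?bf.
  have [->|xa] := eqVneq x a.
    rewrite -fi inpf //; apply: contraNneq be => <-; exact: iae.
  by rewrite inpf // ?inE ?xa ?xe ?orbT //; apply: contraTneq xe => ->.
right; apply/esym/eqP; rewrite eqEcard cf.
have af : a \notin f.
  apply/negP=> af; have := one _ a (iota b) fp1; rewrite !in_setD ap ibp af fi bf.
  by move=> /(_ isT isT) h; move: ae; rewrite h (negbTE ibe).
have inpf y : y \in p -> y != iota a -> y \in f.
  move=> yp yb; apply: contraNT yb => yf; apply/eqP.
  by apply: (one _ _ _ pf1); rewrite in_setD ?yf ?fi ?af.
apply/andP; split.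
  apply/subsetP=> x; rewrite !inE => /or3P[/eqP -> //|/eqP ->|/and3P[xia xa xe]].
    by rewrite fi.
  by rewrite inpf // !inE xa xe orbT.
rewrite /swap_pair !cardsU1 !inE (negbTE ibe) (negbTE be) !andbF orbF eq_sym ib.
have := cardsD1 a e; rewrite ae ce; have := cardsD1 (iota a) (e :\ a).
rewrite in_setD1 ia iae; clear -r1; lia.
Qed.

Section Pair.
Variables (e : {set 'I_n}) (a b b' : 'I_n).
Hypotheses (eE : e \in E) (me : m e = e) (ae : a \in e).
Hypotheses (be : b \notin e) (b'e : b' \notin e).
Hypotheses (ib : iota b != b) (ib' : iota b' != b').
Hypotheses (b'b : b' != b) (b'ib : b' != iota b).

Let p := b |: (e :\ a).

Lemma card_edge : #|e| = r. Proof. by apply/eqP; move: eE; rewrite inE. Qed.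

Lemma broken_edge c : c \notin e -> c |: (e :\ a) \in E.
Proof.
move=> ce; by rewrite inE cardsU1 in_setD1 (negbTE ce) andbF -card_edge (cardsD1 a e) ae.
Qed.

Lemma broken_moved c : c \notin e -> iota c != c -> m (c |: (e :\ a)) != c |: (e :\ a).
Proof.
move=> ce ic; apply: (@not_fixed _ c); first exact: setU11.
by rewrite in_setU1 in_setD1 (negbTE ic) (edge_perm_fix _ me) (negbTE ce) andbF.
Qed.

Lemma near_broken_self : near p e.
Proof.
rewrite /near (_ : p :&: e = e :\ a).
  by rewrite -card_edge (cardsD1 a e) ae.
apply/setP=> x; rewrite !inE; case: (eqVneq x b) => [->|_] /=; first by rewrite (negbTE be) andbF.
by case: (x \in e); rewrite ?andbT ?andbF.
Qed.

Lemma orthogonal_broken : (\sum_f gap f * (near p f)%:R = 0)%R.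
Proof.
rewrite -bil_point; apply: (gap_orthogonal (q := b' |: (e :\ a)));
  rewrite ?broken_edge ?broken_moved //.
  apply/eqP=> /setP/(_ b'); rewrite setU11 !inE (negbTE b'b) (negbTE b'e) andbF. by [].
apply/eqP=> /setP/(_ b'); rewrite setU11 in_m !inE (edge_perm_fix _ me) (negbTE b'e) andbF orbF.
by move/esym/eqP=> h; move: b'ib; rewrite -h inv eqxx.
Qed.

Hypothesis ia : iota a != a.

Lemma swap_pair_edge : swap_pair e a b \in E /\ m (swap_pair e a b) = swap_pair e a b.
Proof.
have iae : iota a \in e by rewrite (edge_perm_fix _ me).
have ibe : iota b \notin e by rewrite (edge_perm_fix _ me).
split.
  rewrite inE /swap_pair !cardsU1 !inE (negbTE ibe) (negbTE be) !andbF orbF (eq_sym b) ib.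
  have := cardsD1 a e; rewrite ae card_edge; have := cardsD1 (iota a) (e :\ a).
  rewrite in_setD1 ia iae; clear => h1 h2; by rewrite h2 h1.
apply/eqP/edge_perm_fixP=> x; rewrite !inE => /or3P[/eqP ->|/eqP ->|/and3P[x1 x2 x3]].
- by rewrite eqxx orbT.
- by rewrite inv eqxx.
rewrite !(inj_eq perm_inj) x2 (edge_perm_fix _ me) x3 (_ : iota x != a) ?orbT //.
by apply: contraNneq x1 => <-; rewrite inv.
Qed.

Lemma gap_swap : (gap e + gap (swap_pair e a b) = 0)%R.
Proof.
have [sE sm] := swap_pair_edge.
have es : swap_pair e a b != e by apply: contraNneq be => <-; rewrite setU11.
have nps : near p (swap_pair e a b).
  have iae : iota a \in e by rewrite (edge_perm_fix _ me).
  have ibe : iota b \notin e by rewrite (edge_perm_fix _ me).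
  rewrite /near (_ : _ :&: _ = b |: (e :\ a :\ iota a)).
    rewrite cardsU1 !inE (negbTE be) !andbF.
    have := cardsD1 a e; rewrite ae card_edge; have := cardsD1 (iota a) (e :\ a).
    rewrite in_setD1 ia iae; clear => h1 h2; by rewrite h2 h1.
  apply/setP=> x; rewrite !inE; case: (eqVneq x b) => //= xb.
  case: (eqVneq x (iota b)) => [->|_] /=; first by rewrite (negbTE ibe) !andbF.
  by case: (x == iota a); case: (x == a); case: (x \in e).
have := orthogonal_broken; rewrite (bigD1 e) //= near_broken_self mulr1.
rewrite (bigD1 (swap_pair e a b)) //= nps mulr1 big1 ?addr0 // => f /andP[fe fs].
have [/andP[fE /eqP mf]|/gap_eq0 ->] := boolP ((f \in E) && (m f == f)); last by rewrite mul0r.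
case npf: (near p f); last by rewrite mulr0.
by have [] := near_broken eE me ae ia be ib fE mf npf => h; move: fe fs; rewrite h eqxx.
Qed.

End Pair.

(** Replacing a 2-cycle of [e] by either of two others gives three invariant edges,
any two of which differ by an exchange of 2-cycles. By [gap_swap] any two of
their gaps are opposite, hence all are zero. *)
Lemma gap_moved e a : e \in E -> m e = e -> a \in e -> iota a != a -> gap e = 0%R.
Proof.
move=> eE me ae ia; have ce := card_edge eE.
have iae : iota a \in e by rewrite (edge_perm_fix _ me).
have lt2 k : k <= 2 * r + 2 -> k + r < n by clear -nbig; lia.
have [|b1 b1e ib1] := @fresh e; first by apply: lt2; rewrite ce; clear; lia.
have [|b2 + ib2] := @fresh (e :|: [set b1; iota b1]).
  apply: lt2; have [h _] := leq_card_setU e [set b1; iota b1].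
  by move: h; rewrite ce cards2; case: (_ != _); clear; lia.
rewrite !inE !negb_or => /andP[b2e /andP[b21 b2i1]].
have b12 : b1 != b2 by rewrite eq_sym.
have b1i2 : b1 != iota b2 by apply: contraNneq b2i1 => ->; rewrite inv.
have ib1e : iota b1 \notin e by rewrite (edge_perm_fix _ me).
have ib2e : iota b2 \notin e by rewrite (edge_perm_fix _ me).
have s1 := gap_swap eE me ae b1e b2e ib1 ib2 b21 b2i1 ia.
have s2 := gap_swap eE me ae b2e b1e ib2 ib1 b12 b1i2 ia.
have [s1E s1m] := swap_pair_edge eE me ae b1e ib1 ia.
pose e1 := swap_pair e a b1.
have b1e1 : b1 \in e1 by rewrite setU11.
have b2e1 : b2 \notin e1.
  by rewrite !inE (negbTE b21) (negbTE b2i1) (negbTE b2e) !andbF.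
have ab1 : a != b1 by apply: contraNneq b1e => <-.
have aib1 : a != iota b1 by apply: contraNneq ib1e => <-.
have ab2 : a != b2 by apply: contraNneq b2e => <-.
have aib2 : a != iota b2 by apply: contraNneq ib2e => <-.
have ae1 : a \notin e1 by rewrite !inE (negbTE ab1) (negbTE aib1) eqxx andbF.
have s3 := gap_swap s1E s1m b1e1 b2e1 ae1 ib2 ia ab2 aib2 ib1.
have e12 : swap_pair e1 b1 b2 = swap_pair e a b2.
  apply/setP=> x; rewrite !inE.
  have [->|x1] := eqVneq x b1; first by rewrite (negbTE b1e) !andbF.
  have [->|xi1] := eqVneq x (iota b1); first by rewrite (negbTE ib1e) !andbF.
  by [].
rewrite e12 in s3.
have solve (x y z : int) : (x + y = 0 -> x + z = 0 -> y + z = 0 -> x = 0)%R by clear; lia.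
exact: solve s1 s2 s3.
Qed.

(** An invariant edge without moved vertices must consist of all fixed points, so
it is the only one of its kind. By [gap_moved] it then contributes the only
term to the orthogonality of [gap] to an edge obtained from it by exchanging
a fixed point for a moved vertex. *)
Lemma gap0 e : gap e = 0%R.
Proof.
have [/andP[eE /eqP me]|/gap_eq0 //] := boolP ((e \in E) && (m e == e)).
have ce := card_edge eE.
have [/existsP[a /andP[ae ia]]|/existsPn fix_all] :=
    boolP [exists a, (a \in e) && (iota a != a)]; first exact: gap_moved ae ia.
have eF : e = fixpoints iota.
  apply/eqP; rewrite eqEcard ce fixr andbT; apply/subsetP=> x xe.
  by have := fix_all x; rewrite xe inE negbK.
have [a ae] : exists a, a \in e by apply/card_gt0P; rewrite ce; clear -r1; lia.
have lt2 k : k <= 2 * r + 2 -> k + r < n by clear -nbig; lia.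
have [|b1 b1e ib1] := @fresh e; first by apply: lt2; rewrite ce; clear; lia.
have [|b2 + ib2] := @fresh (e :|: [set b1; iota b1]).
  apply: lt2; have [h _] := leq_card_setU e [set b1; iota b1].
  by move: h; rewrite ce cards2; case: (_ != _); clear; lia.
rewrite !inE !negb_or => /andP[b2e /andP[b21 b2i1]].
have := orthogonal_broken eE me ae b1e b2e ib1 ib2 b21 b2i1.
rewrite (bigD1 e) //= near_broken_self // mulr1 big1 ?addr0 // => f fe.
have [/andP[fE /eqP mf]|/gap_eq0 ->] := boolP ((f \in E) && (m f == f)); last by rewrite mul0r.
have [/existsP[c /andP[cf ic]]|/existsPn fix_f] :=
    boolP [exists c, (c \in f) && (iota c != c)]; first by rewrite (gap_moved fE mf cf ic) mul0r.
case/eqP: fe; apply/eqP; rewrite eqEcard ce (card_edge fE) leqnn andbT.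
by rewrite eF; apply/subsetP=> x xf; have := fix_f x; rewrite xf inE negbK.
Qed.

Lemma absorbed : G \in cube E m A.
Proof.
apply/cubeP; split=> // e eE; have [me|me] := eqVneq (m e) e; last first.
  by rewrite (moved_edges_split eE me) negbK.
have := gap0 e; rewrite /gap eE me eqxx /=.
by case: (e \in G); case: (e \in A).
Qed.

End Absorb.

(** * The lower bound *)

Lemma lower_bound r n : 2 ^ f_r r n <= max_difference_isomorphic r n.
Proof.
have inv1 (x : 'I_n) : (1 : {perm 'I_n})%g ((1 : {perm 'I_n})%g x) = x by rewrite !perm1.
have [s [inv le1 _]] := refine_involution inv1.
pose m := edge_perm s : {set 'I_n} -> {set 'I_n}.
have mK e : m (m e) = e.
  apply/setP=> x; rewrite /m !edge_permE -{1}(inv x) !mem_imset //; exact: perm_inj.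
have mm : matching (edges n r) m by split=> e; rewrite ?mK // edge_perm_edges.
have cW := card_fixedges_min r inv le1.
have half : #|reps (edges n r) m| = f_r r n.
  have := card_reps mm; rewrite (_ : unmatched _ _ = fixedges r s) // cW -/(defect n r).
  by rewrite card_edges -f_r_defect => h; clear -h; lia.
rewrite -half; apply: leq_trans (card_cube_ge set0 mm) _.
rewrite /max_difference_isomorphic; apply: (@leq_bigmax_cond _ _ (fun F : {set hypergraph n} => #|F|)).
have CP K : K \in cube (edges n r) m set0 -> K \subset edges n r /\
   forall e, e \in edges n r -> (e \in K) = (m e != e) && (m e \notin K).
  move=> /cubeP[KE h]; split=> // e eE; rewrite h //; case: eqP => //=.
  by rewrite inE.
apply/andP; split.
  apply/forall_inP=> K /CP[/subsetP KE _]; apply/forall_inP=> e /KE; by rewrite inE.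
apply/forall_inP=> K /CP[/subsetP KE hK]; apply/forall_inP=> H /CP[/subsetP HE hH].
rewrite isomorphicE; apply/existsP; exists s; apply/swapsP=> e; rewrite -/(m e) !in_setD.
have [eE|eE] := boolP (e \in edges n r).
  have meE : m e \in edges n r by rewrite edge_perm_edges.
  rewrite (hK _ meE) (hH _ meE) mK; have [me|me] := eqVneq (m e) e.
    by rewrite (hK _ eE) (hH _ eE) me eqxx.
  by case: (e \in H); case: (e \in K).
have meE : m e \notin edges n r by rewrite edge_perm_edges.
have eK := contra (KE e) eE; have meH := contra (HE _) meE.
by rewrite (negbTE eK) (negbTE meH) !andbF.
Qed.

(** * The upper bound *)

Section Upper.
(** There are at most 2^(n * l) permutations. By [radius], the permutations
selected with tolerance [n * l + 5] lie in a ball of radius [D], which has at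
most 2^(2 * D * l) elements. With tolerance [2 * D * l + 5], selected
permutations are equal by [separation] and involutions by [rigidity]. *)
Variables (n r l D : nat).
Let beta := 'C(n - 2, r.-1).
Let w := defect n r.
Hypothesis r1 : 1 < r.
Hypothesis nl : n <= 2 ^ l.
Hypothesis degree_large : 2 * r * kappa * n ^ (r - 2) <= beta.
Hypothesis radius : r * (24 * kappa * (n * l + 5) + 2 * w) <= D * beta.
Hypothesis Dn : 2 * D <= n.
Hypothesis separation : 24 * kappa * (2 * D * l + 5) + 2 * w < 2 * beta.
Hypothesis rigidity : 8 * kappa * r * (2 * D * l + 5) < beta.
Hypothesis nbig : 4 * r + 10 <= n.
Local Notation graph := {set {set 'I_n}}.
Let E := edges n r.

Lemma card_perms : #|[set: {perm 'I_n}]| <= 2 ^ (n * l).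
Proof.
by rewrite cardsT card_Sn mulnC expnM; apply: leq_trans (fact_le n) _; apply: leq_expn_base.
Qed.

Variable F : {set graph}.
Hypothesis FE : forall G, G \in F -> G \subset E.
Hypothesis Frel : forall G H, G \in F -> H \in F -> exists s, swaps (edge_perm s) G H.

Definition pick_perm (Th : {set {perm 'I_n}}) (K G : graph) : {perm 'I_n} :=
  odflt 1%g [pick s in Th | swaps (edge_perm s) K G].

Lemma pick_permP Th K G : related Th K G ->
  pick_perm Th K G \in Th /\ swaps (edge_perm (pick_perm Th K G)) K G.
Proof.
case/exists_inP=> s sT sw; rewrite /pick_perm; case: pickP => [t /andP[]//|].
by move/(_ s); rewrite sT sw.
Qed.

Lemma relatedT K G : K \in F -> G \in F -> related [set: {perm 'I_n}] K G.
Proof. by move=> KF GF; have [s sw] := Frel KF GF; apply/exists_inP; exists s. Qed.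

Lemma close_ball (Th : {set {perm 'I_n}}) : (forall s t, s \in Th -> t \in Th ->
    #|shifted r (s * t^-1)%g| <= 24 * kappa * (n * l + 5) + 2 * w) ->
  #|Th| <= 2 ^ (2 * D * l).
Proof.
move=> close; have [->|[s sT]] := set_0Vmem Th; first by rewrite cards0.
have n0 : 0 < n by clear -nbig; lia.
have b0 : 0 < beta by apply: leq_ltn_trans rigidity.
have sub : Th \subset ball s D.
  apply/subsetP=> t tT; rewrite inE -(leq_pmul2r b0).
  apply: leq_trans (card_moved _ (ltnW r1)) _.
  by apply: leq_trans radius; rewrite leq_mul2l close ?orbT.
apply: leq_trans (subset_leq_card sub) _; apply: leq_trans (card_ball s D n0) _.
by apply: leq_trans (leq_expn_base _ nl) _; rewrite -expnM mulnC.
Qed.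

(** The interface of the previous part: if [K0] is related to [F'] by few
permutations, then there are a part [S] of [F'] and a selection [pop k] of the
permutations that relate a fraction 2^(-k) of [S] to other parts of [F'],
such that selecting loses at most one pair in 16, that selected permutations
are close to each other, and that they are almost involutions. *)
Lemma popular_round (F' : {set graph}) (K0 : graph) (Sg : {set {perm 'I_n}}) L :
  F' \subset F -> K0 \in F -> F' != set0 ->
  (forall G, G \in F' -> related Sg K0 G) -> #|Sg| <= 2 ^ L -> L <= n * l ->
  2 ^ (2 * f_r r n) <= 4 * #|F'| ^ 2 ->
  exists S : {set graph}, [/\ S \subset F', S != set0 &
    exists pop : nat -> {set {perm 'I_n}} -> {set {perm 'I_n}},
    [/\ forall k (Th : {set {perm 'I_n}}) s, s \in pop k Th -> s \in Th,
       forall k La (Th : {set {perm 'I_n}}), #|Th| <= 2 ^ La -> L + 5 <= k -> La + 5 <= k ->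
         16 * #|covered Th S F'| <= 16 * #|covered (pop k Th) S F'| + #|S| * #|F'|,
       forall k (Th : {set {perm 'I_n}}) s t, s \in pop k Th -> t \in pop k Th ->
         #|shifted r (s * t^-1)%g| <= 24 * kappa * k + 2 * w
     & forall k (Th : {set {perm 'I_n}}) s, s \in pop k Th ->
         #|moved (s * s)%g| * beta <= 8 * kappa * r * k]].
Proof.
move=> sF K0F F0 rel SgL Ll big.
have [G0 G0F] : exists G0, G0 \in F' by apply/set0Pn.
pose c := pick_perm Sg K0.
have FE' G : G \in F' -> G \subset E by move=> /(subsetP sF)/FE.
have K0E := FE K0F.
have cF G : G \in F' -> swaps (edge_perm (c G)) K0 G by move=> /rel/pick_permP[].
have cS G : G \in F' -> c G \in Sg by move=> /rel/pick_permP[].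
have [s0 s0S max0] := @arg_maxnP _ (c G0) (mem Sg) (fun s => #|cell F' c s|) (cS _ G0F).
have maxS s : s \in Sg -> #|cell F' c s| <= #|cell F' c s0| by apply: max0.
exists (cell F' c s0); split.
- by apply/subsetP=> G /setIdP[].
- rewrite -card_gt0; have := card_largest_cell cS SgL maxS.
  case: (posnP #|cell F' c s0|) => // ->; rewrite muln0 leqn0 cards_eq0.
  by move=> h; rewrite h in F0.
exists (popular_perms r F' c Sg s0); split.
- by move=> k Th s /setIdP[].
- by move=> k La Th ThL Lk Lak; apply: (cover_loss cS SgL big maxS ThL Lk Lak).
- by move=> k Th s t sP tP; apply: (popular_perms_close r1 degree_large FE' K0E cF sP tP).
by move=> k Th s sP; have [] := popular_perms_facts r1 degree_large FE' K0E cF sP.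
Qed.

(** Round one starts from all permutations and yields [K1], related to fifteen
sixteenths of [F] by the permutations [Th1] of a ball. Round two, based at
[K1], first selects [Th2] in a ball, and then [Th3] with the much smaller
tolerance that a ball allows; [separation] and [rigidity] leave one involution
in [Th3]. The losses add up to the fraction (15/16) * (14/16) > 3/4. *)
Lemma upper_bound : #|F| <= 2 ^ f_r r n.
Proof.
rewrite leqNgt; apply/negP=> Fbig.
have [K0 K0F] : exists K0, K0 \in F by apply/card_gt0P; apply: leq_trans Fbig.
have F0 : F != set0 by apply/set0Pn; exists K0.
have Dl : 2 * D * l <= n * l by rewrite leq_mul2r Dn orbT.
have covT (S F' : {set graph}) : S \subset F -> F' \subset F ->
    #|covered [set: {perm 'I_n}] S F'| = #|S| * #|F'|.
  move=> sS sF; rewrite -cardsX; congr #|pred_of_set _|; apply/setP=> -[x y].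
  rewrite in_set; case: (boolP (_ \in setX _ _)) => // /setXP[xS yF].
  by rewrite /= (relatedT (subsetP sS _ xS) (subsetP sF _ yF)).
have big0 : 2 ^ (2 * f_r r n) <= 4 * #|F| ^ 2.
  rewrite mulnC expnM; apply: leq_trans (leq_pmull _ _) => //.
  by rewrite leq_sqr ltnW.
have [S1 [S1F S10 [pop1 [_ loss1 close1 _]]]] := popular_round (subxx F) K0F F0
  (fun G GF => relatedT K0F GF) card_perms (leqnn _) big0.
pose Th1 := pop1 (n * l + 5) [set: {perm 'I_n}].
have cov1 : 15 * (#|S1| * #|F|) <= 16 * #|covered Th1 S1 F|.
  have := loss1 _ _ _ card_perms (leqnn _) (leqnn _); rewrite covT // -/Th1.
  by move: (#|S1| * #|F|) (#|covered _ _ _|) => a b; clear; lia.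
have [K1 K1S avg1] := covered_average S10 cov1.
set F1 := [set G in F | related Th1 K1 G] in avg1.
have Th1L : #|Th1| <= 2 ^ (2 * D * l) by apply: close_ball => s t; apply: close1.
have F1F : F1 \subset F by apply/subsetP=> G /setIdP[].
have big1 : 2 ^ (2 * f_r r n) <= 4 * #|F1| ^ 2.
  rewrite mulnC expnM -(expnMn 2 _ 2) leq_sqr.
  by move: Fbig avg1; move: (2 ^ _) #|F| #|F1| => a b c; clear; lia.
have F10 : F1 != set0.
  apply/eqP=> F10; move: big1; rewrite F10 cards0 muln0 leqn0.
  by have := expn_gt0 2 (2 * f_r r n); case: (2 ^ _).
have [S2 [S2F S20 [pop2 [_ loss2 close2 moved2]]]] := popular_round F1F (subsetP S1F _ K1S) F10
  (fun G GF => proj2 (andP (etrans (esym (in_set _ _)) GF))) Th1L Dl big1.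
have S2F' := subset_trans S2F F1F.
pose Th2 := pop2 (n * l + 5) [set: {perm 'I_n}].
have Th2L : #|Th2| <= 2 ^ (2 * D * l) by apply: close_ball => s t; apply: close2.
have le5 : 2 * D * l + 5 <= n * l + 5 by rewrite leq_add2r.
have cov2 : 15 * (#|S2| * #|F1|) <= 16 * #|covered Th2 S2 F1|.
  have := loss2 _ _ _ card_perms le5 (leqnn _); rewrite covT // -/Th2.
  by move: (#|S2| * #|F1|) (#|covered _ _ _|) => a b; clear; lia.
pose Th3 := pop2 (2 * D * l + 5) Th2.
have cov3 : 14 * (#|S2| * #|F1|) <= 16 * #|covered Th3 S2 F1|.
  have := loss2 _ _ _ Th2L (leqnn _) (leqnn _); rewrite -/Th3; move: cov2.
  by move: (#|S2| * #|F1|) (#|covered _ _ _|) (#|covered _ _ _|) => a b c; clear; lia.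
have [K2 K2S avg2] := covered_average S20 cov3.
set F2 := [set G in F1 | related Th3 K2 G] in avg2.
have F2F : F2 \subset F by apply: subset_trans F1F; apply/subsetP=> G /setIdP[].
have F2big : 3 * 2 ^ f_r r n < 4 * #|F2|.
  by move: Fbig avg1 avg2; move: (2 ^ _) #|F| #|F1| #|F2| => a b c d; clear; lia.
have [G2 G2F] : exists G2, G2 \in F2.
  by apply/card_gt0P; move: F2big; case: #|F2|; rewrite ?muln0.
have [s sT3] : exists s, s \in Th3.
  by case/setIdP: G2F => _ /exists_inP[s sT _]; exists s.
have only t : t \in Th3 -> t = s.
  move=> tT; apply/eqP; rewrite eq_mulgV1; apply/negPn/negP=> ts.
  have := card_shifted_neq1 (ltnW r1) ts; rewrite leqNgt => /negP; apply.
  by apply: leq_ltn_trans (close2 _ _ _ _ tT sT3) separation.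
have inv x : s (s x) = x.
  have : #|moved (s * s)%g| = 0.
    have := leq_ltn_trans (moved2 _ _ _ sT3) rigidity.
    by case: #|_| => // k; rewrite mulSn ltnNge leq_addr.
  by move/eqP; rewrite cards_eq0 => /eqP/setP/(_ x); rewrite !inE permM => /negbFE/eqP.
have K2F : K2 \in F by apply: (subsetP S2F').
have F2sw G : G \in F2 -> swaps (edge_perm s) K2 G.
  by case/setIdP=> _ /exists_inP[t /only ->].
pose m := edge_perm s : {set 'I_n} -> {set 'I_n}; pose R := reach_matching (edge_perm s) K2.
have mK e : m (m e) = e.
  by apply/setP=> x; rewrite /m !edge_permE -{1}(inv x) !mem_imset //; apply: perm_inj.
have mm : matching E m by split=> e; rewrite ?mK // edge_perm_edges.
have Rm : matching E R by apply: reach_matchingP; apply: edge_perm_edges.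
have F2R : F2 \subset cube E R K2.
  apply/subsetP=> G GF.
  exact: (reach_cube (FE K2F) (FE (subsetP F2F _ GF)) (F2sw _ GF)).
have cE : #|E| = 2 * f_r r n + w by rewrite f_r_defect card_edges.
(* The cube of hypergraphs related to K2 by s has more than 2^(f - 1) elements,
   hence at least f free bits; as an involution leaves no fewer than w edges
   invariant, all the other edges must be matched. *)
have reps_big : f_r r n <= #|reps E R|.
  have cF2 := leq_trans (subset_leq_card F2R) (card_cube_le K2 Rm).
  rewrite leqNgt; apply/negP=> lt.
  have : 2 ^ #|reps E R| * 2 <= 2 ^ f_r r n by rewrite -expnSr leq_exp2l.
  by move: F2big cF2; move: (2 ^ f_r r n) (2 ^ _) #|F2|; clear; lia.
have Wge : w <= #|fixedges r s| by apply: defect_involution.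
have WR : fixedges r s = unmatched E R.
  apply/eqP; rewrite eqEcard; apply/andP; split.
    apply/subsetP=> e /setIdP[eE /eqP se]; rewrite in_set -/E eE /= /R /reach_matching se.
    have -> : ((edge_perm s)^-1)%g e = e by rewrite -{1}se permK.
    by case: ifP => _; rewrite ?if_same eqxx.
  have := card_reps Rm; rewrite cE; move: reps_big Wge.
  by move: #|reps _ _| #|unmatched _ _| #|fixedges _ _| (f_r r n); clear; lia.
have Wle : #|fixedges r s| <= w.
  have := card_reps Rm; rewrite cE WR; move: reps_big.
  by move: #|reps _ _| #|unmatched _ _| (f_r r n); clear; lia.
have fixr : #|fixpoints s| <= r by apply: few_fixpoints Wle => //; apply: ltnW.
have Rm_eq e : e \in E -> R e = m e.
  move=> eE; case: (boolP (e \in unmatched E R)).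
    rewrite -WR => eW; have /setIdP[_ /eqP se] := eW.
    by move: eW; rewrite WR => /setIdP[_ /eqP ->]; rewrite /m se.
  rewrite in_set eE /= /R /reach_matching; case: ifP => // _; case: ifP => [_ _|]; last by rewrite eqxx.
  by apply: (@perm_inj _ (edge_perm s)); rewrite permKV -[RHS]/(m (m e)) mK.
have F2C : F2 \subset cube E m K2.
  apply/subsetP=> G /(subsetP F2R)/cubeP[GE h]; apply/cubeP; split=> // e eE.
  by rewrite h // Rm_eq.
have cC : #|cube E m K2| <= 2 ^ f_r r n.
  apply: leq_trans (card_cube_le K2 mm) _; rewrite leq_exp2l //.
  have := card_reps mm; rewrite cE (_ : unmatched E m = fixedges r s) //.
  by move: Wge; move: #|reps _ _| #|fixedges _ _| (f_r r n); clear; lia.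
have most : 4 * #|cube E m K2 :\: F2| < #|cube E m K2|.
  have := cardsID F2 (cube E m K2); rewrite (setIidPr F2C).
  by move: F2big cC; move: #|cube _ _ _| #|_ :\: _| #|F2| (2 ^ _); clear; lia.
have FC : F \subset cube E m K2.
  apply/subsetP=> G GF; apply: (absorbed r1 nbig inv fixr most (FE GF)).
  by move=> K /(subsetP F2F) KF; apply: Frel.
by have := leq_trans (subset_leq_card FC) cC; rewrite leqNgt Fbig.
Qed.

End Upper.

(** * Large numbers of vertices *)

(** With 3 j about [l], the bound 9 c <= j <= 2^j leaves c l^2 <= 2^(3 j). *)
Lemma sqr_log_small c l n : 27 * c + 7 <= l -> 2 ^ l.-1 < n -> c * l ^ 2 <= n.
Proof.
move=> lbig ln; apply: leq_trans (ltnW ln).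
pose j := l.-1 %/ 3; have hl : l <= 3 * j + 3.
  have := ltn_pmod l.-1 (isT : 0 < 3); have := divn_eq l.-1 3; rewrite -/j.
  by move: lbig; move: (l.-1 %% 3) => q; clear; lia.
have cj : 9 * c <= j by clear -lbig hl; lia.
have jp k : k.+1 <= 2 ^ k by apply: ltn_expl.
have h1 : 9 * c <= 2 ^ j by apply: leq_trans cj _; apply: ltnW; apply: jp.
have h2 : l ^ 2 <= 9 * (2 ^ j * 2 ^ j).
  have : l <= 3 * 2 ^ j by have := jp j; clear -hl; lia.
  by move=> h; have := leq_mul h h; rewrite mulnn; move: (2 ^ j) (l ^ 2); clear; lia.
apply: (@leq_trans (2 ^ (3 * j))); last first.
  by rewrite leq_exp2l // mulnC leq_trunc_div.
have -> : 2 ^ (3 * j) = 2 ^ j * (2 ^ j * 2 ^ j) by rewrite -!expnD; congr (2 ^ _); clear; lia.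
apply: leq_trans (leq_mul (leqnn c) h2) _.
by rewrite mulnA (mulnC c) leq_mul2r h1 orbT.
Qed.

Lemma ffact_ge a k : (a - k.-1) ^ k <= a ^_ k.
Proof.
elim: k => // k IH; rewrite ffactnSr expnSr /=; apply: leq_mul => //.
by apply: leq_trans IH; apply: leq_expn_base; rewrite leq_sub2l ?leq_pred.
Qed.

(** Each of the [r.-1] factors of the falling factorial is at least n / 2. *)
Lemma exp_le_bin r n : 1 < r -> 2 * r <= n ->
  n ^ r.-1 <= (2 ^ r.-1 * (r.-1)`!) * 'C(n - 2, r.-1).
Proof.
move=> r1 rn; rewrite -mulnA (mulnC _`!) bin_ffact.
apply: leq_trans (leq_mul (leqnn _) (ffact_ge _ _)).
by rewrite -expnMn; apply: leq_expn_base; clear -r1 rn; lia.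
Qed.

Lemma defect_small r n : 1 < r -> 2 <= n -> 2 * n ^ (r - 2) <= 'C(n - 2, r.-1) ->
  2 * defect n r <= 'C(n - 2, r.-1) + 2.
Proof.
move=> r1 n2 h; rewrite /defect; case: ifP => _; first by rewrite muln0.
have [r2|r2] := eqVneq r 2.
  rewrite r2 /= !bin1; have := odd_double_half n; clear -n2; lia.
apply: leq_trans (leq_addr _ _); apply: leq_trans h; rewrite leq_mul2l /=; apply: leq_trans (bin_leq_exp _ _) _.
apply: (@leq_trans (n ^ r./2)).
  by apply: leq_expn_base; have := odd_double_half n; clear; lia.
rewrite leq_pexp2l //; first by clear -n2; lia.
by have := odd_double_half r; move/eqP: r2; clear -r1; lia.
Qed.

Theorem theorem1p2 (r : nat) (hr : 2 <= r) :
  exists n0 : nat, forall n : nat, n0 <= n ->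
    max_difference_isomorphic r n = 2 ^ f_r r n.
Proof.
(* n^(r-1) <= c * beta; the radius of the ball is d * l; and c2 is large enough
   for every condition on n to follow from c2 * l^2 <= n. *)
pose c := 2 ^ r.-1 * (r.-1)`!.
pose d := r * (24 * kappa * (c + 5) + 3).
pose c2 := c * (24 * kappa * r * (2 * d + 5) + 3) + 2 * d + 2 * r * kappa * c + 4 * r + 10.
exists (2 ^ (27 * c2 + 7)).+1 => n nbig.
pose l := up_log 2 n.
have n1 : 1 < n by apply: leq_trans nbig; rewrite ltnS expn_gt0.
have nl : n <= 2 ^ l by apply: up_logP.
have ln : 2 ^ l.-1 < n by apply: up_log_gtn.
have lbig : 27 * c2 + 7 <= l.
  by rewrite -(leq_exp2l _ _ (isT : 1 < 2)); apply: leq_trans nl; apply: leq_trans nbig.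
have c2l := sqr_log_small lbig ln.
have l0 : 0 < l by apply: leq_trans lbig; rewrite addnS.
have c2n : c2 <= n by apply: leq_trans c2l; rewrite leq_pmulr // expn_gt0 l0.
have n4 : 4 * r + 10 <= n by apply: leq_trans c2n; rewrite /c2 -addnA leq_addl.
have hc : n ^ r.-1 <= c * 'C(n - 2, r.-1).
  by apply: exp_le_bin => //; apply: leq_trans n4; clear; lia.
have c0 : 0 < c by rewrite muln_gt0 expn_gt0 fact_gt0.
pose beta := 'C(n - 2, r.-1).
have degree_large : 2 * r * kappa * n ^ (r - 2) <= beta.
  rewrite -(leq_pmul2l c0); apply: leq_trans hc.
  have -> : r.-1 = (r - 2).+1 by clear -hr; lia.
  rewrite expnS mulnA leq_mul2r; apply/orP; right; apply: leq_trans c2n.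
  rewrite mulnC /c2; clear; lia.
have nc : n <= c * beta.
  by apply: leq_trans hc; rewrite -{1}(expn1 n) leq_pexp2l //; clear -hr n1; lia.
have w2 : 2 * defect n r <= beta + 2.
  apply: defect_small => //.
  apply: leq_trans degree_large; rewrite leq_mul2r -mulnA leq_pmulr ?orbT //.
  by rewrite muln_gt0 andbT; apply: ltnW.
have dl1 : 24 * kappa * (c * l + 5) + 3 <= (24 * kappa * (c + 5) + 3) * l.
  by move: kappa => k; clear -l0; nia.
apply/eqP; rewrite eqn_leq lower_bound andbT.
apply/bigmax_leqP=> F /andP[/forall_inP uF /forall_inP dF].
have l2 : l <= l ^ 2 by rewrite -{1}(expn1 l) leq_pexp2l.
have big k : k <= c2 -> k * l ^ 2 <= n by move=> kc; apply: leq_trans c2l; rewrite leq_mul2r kc orbT.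
have b0 : 0 < beta.
  by case: (posnP beta) nc => // ->; rewrite muln0; clear -n1; lia.
have key : 24 * kappa * r * (2 * (d * l) * l + 5) + 3 <= beta.
  rewrite -(leq_pmul2l c0); apply: leq_trans nc.
  apply: leq_trans (big (c * (24 * kappa * r * (2 * d + 5) + 3)) _).
    rewrite -(mulnA c) leq_mul2l; apply/orP; right.
    have l2' : 0 < l ^ 2 by rewrite expn_gt0 l0.
    rewrite (_ : 2 * (d * l) * l = 2 * d * l ^ 2); last by rewrite -!mulnA mulnn.
    rewrite mulnDl -(mulnA (24 * kappa * r)); apply: leq_add; last by rewrite leq_pmulr.
    by rewrite leq_mul2l mulnDl leq_add2l leq_pmulr ?orbT.
  by rewrite /c2 -!addnA leq_addr.
apply: (@upper_bound n r l (d * l)) => //.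
- have -> : d * l * 'C(n - 2, r.-1) = r * ((24 * kappa * (c + 5) + 3) * l * beta).
    by rewrite /d -!mulnA.
  rewrite leq_mul2l; apply/orP; right.
  apply: (@leq_trans ((24 * kappa * (c * l + 5) + 3) * beta)); last first.
    by rewrite leq_mul2r dl1 orbT.
  rewrite mulnDl -(mulnA (24 * kappa)); apply: leq_add; last first.
    by apply: leq_trans w2 _; clear -b0; lia.
  rewrite leq_mul2l mulnDl; apply/orP; right; apply: leq_add; last by rewrite leq_pmulr.
  by rewrite mulnAC leq_mul2r nc orbT.
- rewrite mulnA; apply: leq_trans (leq_mul (leqnn _) l2) _; apply: big.
  by rewrite /c2; clear; lia.
- have : 24 * kappa * (2 * (d * l) * l + 5) <= 24 * kappa * r * (2 * (d * l) * l + 5).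
    by rewrite leq_mul2r leq_pmulr ?orbT // ltnW.
  have sep x y w b : x <= y -> y + 3 <= b -> 2 * w <= b + 2 -> x + 2 * w < 2 * b by clear; lia.
  by move=> h; apply: sep h key w2.
- apply: leq_trans key; rewrite -addn1; apply: leq_add => //.
  by rewrite leq_mul2r; apply/orP; right; rewrite !leq_mul2r !orbT.
- move=> G GF; apply/subsetP=> e eG; rewrite inE.
  by have /forall_inP := uF _ GF; apply.
by move=> G H GF HF; have /forall_inP/(_ _ HF) := dF _ GF; rewrite isomorphicE => /existsP.
Qed.
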